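(* Let $G$ be a simple, weakly connected symmetric graph with $2n+1$ vertices. Let $\mathrm{Acyc}(G)$ be the set of symmetric acyclic orientations of $G$, let $\sim$ be the equivalence relation on $\mathrm{Acyc}(G)$ generated by flips, and let $\chi_G(k,l)$ be the bivariate chromatic polynomial of $G$. Then $$|\mathrm{Acyc}(G)/{\sim}|=(-1)^n\chi_G(-1,2).$$
   Context: A symmetric graph is a graph $G=(V,E)$ on vertices $V=\{v_{-n},v_{-(n-1)},\dots,v_0,v_1,\dots,v_n\}$ such that if $(v_i,v_j)\in E$ then $(v_{-i},v_{-j})\in E$. It is simple if it has no loops and no multiple edges. It is weakly connected if $v_i$ is connected (by a path in $G$) to $v_{-i}$ for all $i\neq 0$. For integers $k,l\ge 1$, a proper $(k,l)$-coloring of $G$ is a map $f:V\to\{0,\pm1,\dots,\pm k\}\cup\{0_1,\dots,0_{l-1}\}$, where the colors are all distinct and $-0=0$, $-0_i=0_i$, such that $f(v_0)=0$; $f(v_i)=-f(v_{-i})$ for all $i\neq 0$; and $f(v_i)\neq f(v_j)$ for every edge $v_iv_j\in E$. The number of proper $(k,l)$-colorings is a polynomial in $k$ and $l$; this polynomial is the bivariate chromatic polynomial $\chi_G(k,l)$. A symmetric acyclic orientation of $G$ is an acyclic orientation of $G$ such that if $v_i\to v_j$ then $v_{-j}\to v_{-i}$. If $i\neq0$ and $v_i$ is a source (resp. sink) of such an orientation $\omega$, then $v_{-i}$ is a sink (resp. source); if moreover $v_iv_{-i}$ is not an edge of $G$, then $(v_i,v_{-i})$ is called a source-sink pair of $\omega$.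 Reversing the direction of all edges adjacent to $v_i$ or $v_{-i}$ for a source-sink pair $(v_i,v_{-i})$ gives another symmetric acyclic orientation $\omega'$, and one says $\omega$ and $\omega'$ differ by a flip. The relation $\sim$ is the equivalence relation on $\mathrm{Acyc}(G)$ given by the transitive closure of flips. *)

(* Defs.v *)
From HB Require Import structures.
From mathcomp Require Import all_boot all_order all_algebra zify.

Set Implicit Arguments.
Unset Strict Implicit.
Unset Printing Implicit Defensive.

Import GRing.Theory.
Local Open Scope ring_scope.

(* The index set {-n, ..., n}: the ordinal i stands for the integer i - n, so *)
(* that negation is rev_ord and zero is the middle element.                   *)
Notation signed n := 'I_(2 * n).+1 (only parsing).
Definition szero n : signed n := inord n.
Definition sopp n (i : signed n) : signed n := rev_ord i.

Lemma soppK n : involutive (@sopp n).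
Proof. exact: rev_ordK. Qed.

Lemma sopp_eq n (i : signed n) : (sopp i == i) = (i == szero n).
Proof.
by rewrite -!val_eqE /= inordK; have := ltn_ord i; last lia; move=> lt_i_n; lia.
Qed.

Lemma sopp0 n : sopp (szero n) = szero n.
Proof. by apply/eqP; rewrite sopp_eq. Qed.

(* A graph on v_{-n}, ..., v_n is its adjacency relation on signed n; it is   *)
(* simple when this relation is symmetric and irreflexive.                    *)

(* Invariance under v_i |-> v_{-i}; not to be confused with ssrbool.symmetric *)
(* (e x y = e y x), which says that the edges are undirected.                 *)
Definition symmetric_graph n (e : rel (signed n)) :=
  forall i j, e i j -> e (sopp i) (sopp j).

Definition weakly_connected n (e : rel (signed n)) :=
  forall i, i != szero n -> connect e i (sopp i).

(* inl a is the color a in {-k, ..., k}, inr z the color 0_{z+1}; this is     *)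
(* meant for k, l >= 1.                                                       *)
Notation color k l := ('I_(2 * k).+1 + 'I_l.-1)%type (only parsing).

Definition czero k l : color k l := inl (szero k).

Definition copp k l (c : color k l) : color k l :=
  match c with inl a => inl (sopp a) | inr z => inr z end.

Definition is_signed_map n k l (f : {ffun signed n -> color k l}) :=
  (f (szero n) == czero k l) &&
  [forall i, (i != szero n) ==> (f i == copp (f (sopp i)))].

Definition is_proper_coloring n (e : rel (signed n)) k l
    (f : {ffun signed n -> color k l}) :=
  is_signed_map f && [forall i, forall j, e i j ==> (f i != f j)].

Definition num_colorings n (e : rel (signed n)) (k l : nat) : nat :=
  #|[set f : {ffun signed n -> color k l} | is_proper_coloring e f]|.

(* chi.[x, y] is chi.[x%:P].[y]: the outer variable of chi is k, the inner    *)
(* one is l.                                                                  *)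
Definition is_bichromatic_poly n (e : rel (signed n))
    (chi : {poly {poly int}}) :=
  forall k l : nat, (0 < k)%N -> (0 < l)%N ->
    chi.[k%:Z, l%:Z] = (num_colorings e k l)%:Z.

Lemma coppK k l : involutive (@copp k l).
Proof. by case=> [a|z] //=; rewrite soppK. Qed.

Lemma copp0 k l : copp (czero k l) = czero k l.
Proof. by rewrite /copp /= sopp0. Qed.

Lemma card_copp_fixed k l : (0 < l)%N ->
  #|[pred c : color k l | copp c == c]| = l.
Proof.
move=> l_gt0; rewrite -sum1_card big_sumType /=.
rewrite (eq_bigl (pred1 (szero k))); last first.
  by move=> a; rewrite !inE (inj_eq (@inl_inj _ _)) sopp_eq.
rewrite big_pred1_eq (eq_bigl xpredT); last by move=> z; rewrite !inE eqxx.
by rewrite sum1_card card_ord add1n prednK.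
Qed.

Lemma card_color k l : (0 < l)%N -> #|{: color k l}| = (2 * k + l)%N.
Proof. by move=> l_gt0; rewrite card_sum !card_ord addSnnS prednK. Qed.

Lemma is_signed_mapP n k l (f : {ffun signed n -> color k l}) :
  reflect (f (szero n) = czero k l /\ forall i, f (sopp i) = copp (f i))
          (is_signed_map f).
Proof.
apply: (iffP andP) => [[/eqP f0 /forallP fN]|[f0 fN]].
  split=> // i; have [->|i0] := eqVneq i (szero n).
    by rewrite sopp0 f0 copp0.
  by have /implyP/(_ i0)/eqP-> := fN i; rewrite coppK.
by split; [apply/eqP | apply/forallP=> i; rewrite fN coppK eqxx implybT].
Qed.

(* Signed maps subject to finitely many equations are counted by a product    *)
(* over the classes, up to sign, of the variables that the equations tie.     *)
Section Equations.

Variables (n : nat) (Q : seq (signed n * signed n)).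

Let eqs k l (f : {ffun signed n -> color k l}) :=
  all (fun p => f p.1 == f p.2) Q.

Let r x y := [|| (x, y) \in Q, (y, x) \in Q, (sopp x, sopp y) \in Q
               | (sopp y, sopp x) \in Q].
Let c := connect r.
Let d x y := c x y || c x (sopp y).
Let rep x := choose (d x) x.

Let cS : connect_sym r.
Proof.
apply: sym_connect_sym => a b; rewrite /r.
by case: ((a, b) \in Q); case: ((b, a) \in Q); rewrite //= orbC.
Qed.
Let cC x y : c x y = c y x. Proof. exact: cS. Qed.

Let cN x y : c (sopp x) (sopp y) = c x y.
Proof.
suff H a b : c a b -> c (sopp a) (sopp b).
  by apply/idP/idP => /H //; rewrite !soppK.
case/connectP=> s; elim: s a => [|a' s IHs] a /=.
  by move=> _ ->; apply: connect0.
move=> /andP[aa' s_p] bE; apply: connect_trans (IHs _ s_p bE).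
apply: connect1; rewrite /r !soppK.
by move: aa'; rewrite /r; do 4!case: (_ \in Q).
Qed.

Let c_trans : transitive c. Proof. exact: connect_trans. Qed.
Let cxx x : c x x. Proof. exact: connect0. Qed.

Let dxx x : d x x. Proof. by rewrite /d cxx. Qed.

Let d_eq x y : d x y -> d x =1 d y.
Proof.
move=> dxy z; rewrite /d.
have cE a b : c a b -> c a =1 c b by exact: same_connect cS _ _.
case/orP: dxy => [/cE E|/cE E]; first by rewrite !E.
by rewrite !E -[c (sopp y) z]cN soppK cN orbC.
Qed.

Let drep x : d x (rep x). Proof. exact: chooseP (dxx x). Qed.

Let rep_eq x y : d x y -> rep x = rep y.
Proof.
move=> dxy; rewrite /rep (eq_choose (d_eq dxy)).
by apply: choose_id; rewrite // -(d_eq dxy).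
Qed.

Let rep_id x : rep (rep x) = rep x. Proof. exact/esym/rep_eq. Qed.
Let repN x : rep (sopp x) = rep x.
Proof. by apply: rep_eq; rewrite /d cxx orbT. Qed.

Let F k l (x : signed n) : pred (color k l) :=
  if rep x != x then pred1 (czero k l)
  else if c x (szero n) then pred1 (czero k l)
  else if c x (sopp x) then [pred a | copp a == a] else predT.

Let P (x : signed n) : {poly {poly int}} :=
  if rep x != x then 1 else if c x (szero n) then 1
  else if c x (sopp x) then 'Y else 2%:R * 'X + 'Y.

Let card_F k l x : (0 < l)%N -> #|@F k l x|%:Z = (P x).[k%:Z, l%:Z].
Proof.
move=> l_gt0; rewrite /F /P.
case: ifP => _; first by rewrite card1 !hornerE.
case: ifP => _; first by rewrite card1 !hornerE.
case: ifP => _; first by rewrite card_copp_fixed // !hornerE.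
by rewrite card_color // !hornerE PoszD PoszM.
Qed.

Let eqs_c k l (f : {ffun signed n -> color k l}) x y :
  is_signed_map f -> eqs f -> c x y -> f x = f y.
Proof.
move=> /is_signed_mapP[_ fN] /allP fQ /connectP[s].
elim: s x => [x _ -> //|z s IHs x /= /andP[xz /IHs{}IHs] /IHs <-].
case/or4P: xz => /fQ/eqP //= E; apply: (can_inj (@coppK k l));
  by rewrite -?fN E.
Qed.

Let restr k l (f : {ffun signed n -> color k l}) :=
  [ffun x => if rep x == x then f x else czero k l].
Let extend k l (g : {ffun signed n -> color k l}) :=
  [ffun x => if c x (rep x) then g (rep x) else copp (g (rep x))].

Let extendK k l (f : {ffun signed n -> color k l}) :
  is_signed_map f -> eqs f -> extend (restr f) = f.
Proof.
move=> fS fQ; apply/ffunP=> x; rewrite !ffunE rep_id eqxx.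
have [_ fN] := is_signed_mapP _ fS.
have := drep x; rewrite /d; case: ifP => [cx _|_ /= cx].
  exact/esym/eqs_c.
by rewrite -fN; apply/esym/eqs_c.
Qed.

Let restrK k l (g : {ffun signed n -> color k l}) :
  g \in family (@F k l) -> restr (extend g) = g.
Proof.
move=> /familyP gF; apply/ffunP=> x; rewrite !ffunE.
have [rx|rx] := eqVneq (rep x) x; first by rewrite rx cxx.
by have := gF x; rewrite /F rx => /eqP.
Qed.

Let restrF k l (f : {ffun signed n -> color k l}) :
  is_signed_map f -> eqs f -> restr f \in family (@F k l).
Proof.
move=> fS fQ; have [f0 fN] := is_signed_mapP _ fS.
apply/familyP=> x; rewrite /F ffunE; case: eqVneq => [_|_] /=; last first.
  by rewrite unfold_in /= eqxx.
case: ifP => [cx|_]; first by rewrite unfold_in /= (eqs_c fS fQ cx) f0.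
case: ifP => [cx|_]; last by [].
by rewrite unfold_in /= -fN (eqs_c fS fQ cx).
Qed.

Let extend_eqs k l (g : {ffun signed n -> color k l}) :
  g \in family (@F k l) -> is_signed_map (extend g) && eqs (extend g).
Proof.
move=> /familyP gF; apply/andP; split; last first.
  apply/allP=> -[x y] xyQ; rewrite !ffunE /=.
  have cxy : c x y by apply: connect1; rewrite /r xyQ.
  rewrite (@rep_eq x y) ?/d ?cxy //.
  by rewrite [c x _](same_connect cS cxy).
apply/is_signed_mapP; split.
  rewrite ffunE; set y := rep _.
  have cy : c (szero n) y.
    by have := drep (szero n); rewrite /d -[c _ (sopp _)]cN sopp0 soppK orbb.
  by rewrite cy; have := gF y; rewrite /F rep_id eqxx cC cy => /eqP.
move=> x; rewrite !ffunE repN -[c (sopp x) _]cN soppK.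
have := drep x; rewrite /d; set y := rep x.
have [cx|_] := boolP (c x y); last by move=> /= ->; rewrite coppK.
have [cx' _|//] := boolP (c x (sopp y)).
have cy : c y (sopp y) by apply: c_trans cx'; rewrite cC.
have := gF y; rewrite /F rep_id eqxx cy /=.
by case: ifP => _ /eqP gy; rewrite ?gy ?copp0.
Qed.

Lemma equations_poly : {chi : {poly {poly int}} |
  forall k l : nat, (0 < l)%N -> chi.[k%:Z, l%:Z] =
    #|[set f : {ffun signed n -> color k l} | is_signed_map f && eqs f]|%:Z}.
Proof.
exists (\prod_x P x) => k l l_gt0; rewrite !horner_prod.
under eq_bigr do rewrite -card_F //.
rewrite -(big_morph _ PoszM (erefl 1%:Z)); congr (Posz _).
transitivity #|family (@F k l)|; first by rewrite card_family foldrE big_image.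
rewrite -(card_in_imset (f := @restr k l)); last first.
  move=> f g; rewrite !inE => /andP[fS fQ] /andP[gS gQ] fg.
  by rewrite -(extendK fS fQ) fg extendK.
apply: eq_card => g; apply/idP/imsetP => [gF|[f]].
  by exists (extend g); rewrite ?inE ?extend_eqs ?restrK.
by rewrite inE => /andP[fS fQ] ->; apply: restrF.
Qed.

End Equations.

Lemma constraints_poly n (D Q : seq (signed n * signed n)) :
  {chi : {poly {poly int}} |
    forall k l : nat, (0 < l)%N -> chi.[k%:Z, l%:Z] =
      #|[set f : {ffun signed n -> color k l} |
          [&& is_signed_map f, all (fun p => f p.1 == f p.2) Q
            & all (fun p => f p.1 != f p.2) D]]|%:Z}.
Proof.
elim: D Q => [|p D IHD] Q.
  have [chi chiP] := equations_poly Q; exists chi => k l /chiP->.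
  by congr (Posz #|pred_of_set _|); apply/setP=> f; rewrite !inE andbT.
have [chi1 chi1P] := IHD Q; have [chi2 chi2P] := IHD (p :: Q).
exists (chi1 - chi2) => k l l_gt0; rewrite !hornerD !hornerN chi1P // chi2P //.
set A := [set f | _]; set B := [set f | _].
pose C := [set f : {ffun signed n -> color k l} | f p.1 == f p.2].
rewrite -[in X in X - _](cardsID C A) PoszD addrC.
rewrite [A :&: _](_ : _ = B) ?addKr; last first.
  by apply/setP=> f; rewrite !inE /=; case: (_ == _); rewrite ?andbF ?andbT.
congr (Posz #|pred_of_set _|); apply/setP=> f; rewrite !inE /=.
by case: (_ == _); rewrite ?andbF.
Qed.

Lemma bichromatic_poly_exists n (e : rel (signed n)) :
  {chi : {poly {poly int}} | is_bichromatic_poly e chi}.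
Proof.
have [chi chiP] := constraints_poly [seq p <- enum predT | e p.1 p.2] [::].
exists chi => k l _ l_gt0; rewrite chiP //.
congr (Posz #|pred_of_set _|); apply/setP=> f; rewrite !inE /=.
congr (_ && _); apply/allP/forallP => [fD i|fD [i j]].
  apply/forallP=> j; apply/implyP=> eij.
  by apply: (fD (i, j)); rewrite mem_filter eij mem_enum.
rewrite mem_filter => /andP[/= eij _].
by have /forallP/(_ j) := fD i; rewrite eij.
Qed.

Lemma bichromatic_poly_unique n (e : rel (signed n)) chi1 chi2 :
  is_bichromatic_poly e chi1 -> is_bichromatic_poly e chi2 -> chi1 = chi2.
Proof.
have many0 (R : idomainType) (p : {poly R}) (h : nat -> R) :
    injective h -> (forall m, p.[h m] = 0) -> p = 0.
  move=> h_inj p0; apply: contraTeq isT => p_neq0.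
  have := @max_poly_roots _ p [seq h m | m <- iota 0 (size p)] p_neq0.
  rewrite map_inj_uniq // iota_uniq size_map size_iota ltnn; apply=> //.
  by apply/allP=> _ /mapP[m _ ->]; apply/rootP.
move=> chi1P chi2P; apply/eqP; rewrite -subr_eq0; apply/eqP.
apply: (many0 _ _ (fun m => (m.+1%:Z)%:P)) => [i j /polyC_inj[]//|i].
apply: (many0 _ _ (fun m => m.+1%:Z)) => [a b []//|j].
by rewrite !hornerD !hornerN chi1P // chi2P // subrr.
Qed.

Definition bichromatic_poly n (e : rel (signed n)) : {poly {poly int}} :=
  sval (bichromatic_poly_exists e).

Lemma bichromatic_polyP n (e : rel (signed n)) :
  is_bichromatic_poly e (bichromatic_poly e).
Proof. exact: svalP. Qed.

(* An orientation is the set of its arcs: (i, j) \in o means v_i -> v_j. *)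
Notation arcs n := {set signed n * signed n} (only parsing).

Definition arc n (o : arcs n) : rel (signed n) := fun i j => (i, j) \in o.

Definition is_orientation n (e : rel (signed n)) (o : arcs n) :=
  [forall i, forall j, if e i j then arc o i j (+) arc o j i else ~~ arc o i j].

Definition is_acyclic n (o : arcs n) :=
  [forall i, forall j, arc o i j ==> ~~ connect (arc o) j i].

Lemma is_acyclicP n (o : arcs n) :
  reflect (forall s, cycle (arc o) s -> s = [::]) (is_acyclic o).
Proof.
apply: (iffP forallP) => [oA [//|i s]|oA i].
  rewrite /= rcons_path => /andP[s_path last_i].
  have /forallP/(_ i)/implyP/(_ last_i)/negP[] := oA (last i s).
  by apply/connectP; exists s.
apply/forallP=> j; apply/implyP=> ij; apply/connectP=> -[s s_path iE].
by have := oA (j :: s); rewrite /= rcons_path s_path -iE => /(_ ij).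
Qed.

Definition is_symmetric_orientation n (o : arcs n) :=
  [forall i, forall j, arc o i j ==> arc o (sopp j) (sopp i)].

Definition Acyc n (e : rel (signed n)) : {set arcs n} :=
  [set o | [&& is_orientation e o, is_acyclic o & is_symmetric_orientation o]].

Definition is_source n (o : arcs n) i := [forall j, ~~ arc o j i].
Definition is_sink n (o : arcs n) i := [forall j, ~~ arc o i j].

Definition is_source_sink_pair n (e : rel (signed n)) (o : arcs n) i :=
  [&& i != szero n, ~~ e i (sopp i) & is_source o i || is_sink o i].

Definition flip n (i : signed n) (o : arcs n) : arcs n :=
  [set a | if [|| a.1 == i, a.1 == sopp i, a.2 == i | a.2 == sopp i]
           then (a.2, a.1) \in o else a \in o].

Definition differ_by_flip n (e : rel (signed n)) : rel (arcs n) :=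
  fun o o' => [&& o \in Acyc e, o' \in Acyc e &
    [exists i, is_source_sink_pair e o i && (o' == flip i o)]].

(* connect is the reflexive transitive closure; taking both directions makes  *)
(* it the equivalence relation generated by flips.                            *)
Definition flip_equiv n (e : rel (signed n)) : rel (arcs n) :=
  connect [rel o o' | differ_by_flip e o o' || differ_by_flip e o' o].

Definition flip_classes n (e : rel (signed n)) : {set {set arcs n}} :=
  equivalence_partition (flip_equiv e) (Acyc e).

(* Main.v *)
Require Import Defs.
From mathcomp Require Import all_boot all_order all_algebra.
From mathcomp Require Import zify.

(** Write pm S for the union of S and -S, and G - W for the graph with the
    vertices of W deleted.  The number of flip classes and (-1)^n chi(-1, 2)
    are both the Euler characteristic of a cubical complex.

    The complex has the symmetric acyclic orientations as its vertices.  If the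
    set W of vertices is symmetric, independent and misses v_0, an orientation
    of G - W extends to G by making, for each pair in W, one vertex a source
    and the other a sink; these extensions are the corners of a cube of
    dimension |W|/2 whose edges are flips.  So the Euler characteristic is
    [cube_sum], the sum over W of (-1)^(|W|/2) times the number of orientations
    of G - W.

    It counts the flip classes ([cube_sum_flip_classes]) because each class
    has Euler characteristic 1.  Fix an orientation b in a class.  Counting flips gives each
    orientation o of the class a height h, an odd integer function on the
    vertices such that h x - h y is 1 or 0 for x -> y in b, according to
    whether o reverses the arc or not.  Two heights of the same o differ by a function
    that is constant on connected components; by weak connectivity it takes
    the same value at v_i and v_{-i}, and being odd it vanishes.  Hence the
    height is unique ([height_unique]), and conversely a height can always be
    brought down to 0 by flips ([height_flip_equiv]).  Now attach each cube to
    its corner farthest from b.  The cubes attached to o are given by the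
    subsets of the set of sinks of o of positive height: two adjacent vertices
    cannot both be sinks, and a vertex of positive height is not adjacent to
    one of negative height, so all these flips can be done independently.
    This set is empty only for o = b ([descents_eq0]), so the alternating sum
    over the cubes attached to o is 1 for o = b and 0 otherwise.

    On the other side, removing the vertices colored k+1 and -(k+1) from a
    coloring shows that the number of colorings of G for k+1 is the sum, over
    the independent sets S without opposite vertices, of the number of
    colorings of G - pm S for k ([card_colorings_succ]).  As an identity of
    polynomials this holds at k = -1 too, where for l = 2 the left side counts colorings
    with the two colors 0 and 0_1, and so determines the values at k = -1 by
    induction on the number of vertices.  It remains to see that the signed
    [cube_sum] satisfies the same recursion ([signed_sum_cube_sum]), which
    reduces to [alternating_sum_Acyc]: pairs of a set S and an orientation of
    G - pm S are orientations of G with a chosen set S of sinks, and adding or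
    removing a sink that lies on an edge cancels all of them as soon as G has
    an edge. *)

Set Implicit Arguments.
Unset Strict Implicit.
Unset Printing Implicit Defensive.

(* After this, [arc] again denotes the arcs of an orientation, not [path.arc]. *)
Import Defs.
Import Order.TTheory GRing.Theory Num.Theory.
Local Open Scope ring_scope.

(** * Alternating sums and sets of vertices closed under negation *)

(** The subsets with x and those without x cancel in pairs. *)
Lemma alternating_sum_toggle (T : finType) (P : pred {set T}) (x : T) :
  (forall S, P (x |: S) = P (S :\ x)) ->
  \sum_(S : {set T} | P S) (-1) ^+ #|S| = 0 :> int.
Proof.
move=> Px; rewrite (bigID (fun S : {set T} => x \in S)) /=.
rewrite [X in _ + X](reindex_onto (fun S => S :\ x) (fun S => x |: S));
  last first.
  by move=> S /andP[_ xS]; rewrite setU1K.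
rewrite -[X in X + _]opprK -sumrN; apply/eqP; rewrite addrC subr_eq0; apply/eqP.
apply: eq_big => [S|S /andP[/andP[PS _] xS]].
  rewrite !inE eqxx andbT -Px /=.
  have [xS|xS] := boolP (x \in S).
    by rewrite setD1K // (setUidPr _) ?eqxx ?sub1set.
  rewrite andbF; apply/negbTE/negP => /andP[_ /eqP SE].
  by move: xS; rewrite -SE setU11.
have {}xS : x \in S by rewrite -(eqP xS) setU11.
by rewrite [in RHS](cardsD1 x S) xS exprS mulN1r opprK.
Qed.

Lemma alternating_sum_subsets (T : finType) (D : {set T}) :
  \sum_(S : {set T} | S \subset D) (-1) ^+ #|S| = (D == set0)%:R :> int.
Proof.
have [->|[x xD]] := set_0Vmem D.
  rewrite eqxx (eq_bigl (pred1 set0)) ?big_pred1_eq ?cards0 //.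
  by move=> S; rewrite subset0.
have /negbTE-> : D != set0 by apply/set0Pn; exists x.
apply: (@alternating_sum_toggle _ _ x) => S.
by rewrite subUset sub1set xD subDset (setUidPr _) ?sub1set.
Qed.

Section Signed.
Variable n : nat.
Implicit Types (S U W : {set signed n}) (e : rel (signed n)).

Definition oppset S := @sopp n @^-1: S.
Definition pm S := S :|: oppset S.
Definition symmetric_set U := oppset U == U.
Definition antisymmetric_set S := [disjoint S & oppset S].
Definition independent e S := [forall x in S, forall y in S, ~~ e x y].
Definition induced e U := [rel x y | [&& x \in U, y \in U & e x y]].

Lemma independentP e S :
  reflect {in S &, forall x y, e x y = false} (independent e S).
Proof.
apply: (iffP forall_inP) => [H x y xS yS|H x xS].
  by have /forall_inP/(_ y yS)/negbTE := H x xS.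
by apply/forall_inP=> y yS; rewrite H.
Qed.

Lemma mem_oppset S x : (x \in oppset S) = (sopp x \in S).
Proof. by rewrite inE. Qed.

Lemma symsetN U x : symmetric_set U -> (sopp x \in U) = (x \in U).
Proof. by move=> /eqP UE; rewrite -mem_oppset UE. Qed.

Lemma symmetric_set_forall U :
  (forall x, (sopp x \in U) = (x \in U)) -> symmetric_set U.
Proof. by move=> H; apply/eqP/setP=> x; rewrite inE H. Qed.

Lemma antisymP S :
  reflect (forall x, x \in S -> sopp x \notin S) (antisymmetric_set S).
Proof.
rewrite /antisymmetric_set disjoint_subset.
by apply: (iffP subsetP) => H x /H; rewrite !inE.
Qed.

Lemma mem_pm S x : (x \in pm S) = (x \in S) || (sopp x \in S).
Proof. by rewrite !inE. Qed.

Lemma pm_sym S : symmetric_set (pm S).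
Proof. by apply: symmetric_set_forall => x; rewrite !mem_pm soppK orbC. Qed.

Lemma antisym0 S : antisymmetric_set S -> szero n \notin S.
Proof.
by move=> /antisymP SA; apply/negP => S0; have := SA _ S0; rewrite sopp0 S0.
Qed.

Lemma card_oppset S : #|oppset S| = #|S|.
Proof.
exact: on_card_preimset (onW_bij _ (Bijective (@soppK n) (@soppK n))).
Qed.

Lemma card_pm S : antisymmetric_set S -> #|pm S| = #|S|.*2.
Proof.
move=> SA; rewrite /pm cardsU card_oppset addnn.
by move: SA; rewrite /antisymmetric_set -setI_eq0 => /eqP->; rewrite cards0 subn0.
Qed.

Lemma symsetD U W : symmetric_set U -> symmetric_set W -> symmetric_set (U :\: W).
Proof. by move=> Us Ws; apply: symmetric_set_forall => x; rewrite !inE !symsetN. Qed.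

Definition positive_half W := [set x in W | (n < x)%N].

Lemma positive_half_antisym W : antisymmetric_set (positive_half W).
Proof.
apply/antisymP => x; rewrite !inE => /andP[_ x_gt].
by apply/negP => /andP[_] /=; have := ltn_ord x; lia.
Qed.

Lemma pm_positive_half W :
  symmetric_set W -> pm (positive_half W) = W :\ szero n.
Proof.
move=> Ws; apply/setP=> x; rewrite mem_pm !inE symsetN // -andb_orr andbC.
congr (_ && _); rewrite -val_eqE /= inordK; last by lia.
by have := ltn_ord x; lia.
Qed.

End Signed.

(** * Removing and restoring a set of sinks *)

Section Orientations.
Variable n : nat.
Implicit Types (S U W Y : {set signed n}) (e : rel (signed n)).
Implicit Types (o : {set signed n * signed n}).

Lemma eq_Acyc e1 e2 : e1 =2 e2 -> Acyc e1 = Acyc e2.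
Proof.
move=> E; apply/setP=> o; rewrite !inE; congr (_ && _).
by apply: eq_forallb => i; apply: eq_forallb => j; rewrite E.
Qed.

(** The number of vertices reachable from x strictly decreases along arcs.
    Acyclicity is handled through such ranks because they are easy to modify
    when sinks and sources are adjoined. *)
Lemma acyclic_rankP o :
  reflect (exists r : signed n -> nat, forall x y, arc o x y -> (r y < r x)%N)
          (is_acyclic o).
Proof.
apply: (iffP forallP) => [oA|[r rP] x].
  exists (fun x => #|connect (arc o) x|) => x y xy.
  apply/proper_card/properP; split.
    by apply/subsetP=> z; apply: connect_trans (connect1 xy).
  exists x; first exact: connect0.
  by have /forallP/(_ y)/implyP/(_ xy) := oA x.
apply/forallP=> y; apply/implyP=> xy; apply/negP => /connectP[s].
have rle s' z : path (arc o) z s' -> (r (last z s') <= r z)%N.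
  elim: s' z => //= t s' IHs z /andP[/rP zt /IHs le_rt].
  exact: leq_trans le_rt (ltnW zt).
by move=> /rle le_r xE; have := rP _ _ xy; rewrite xE ltnNge le_r.
Qed.

Lemma AcycP e o : symmetric e ->
  reflect [/\ forall x y, arc o x y -> e x y,
              forall x y, e x y -> arc o y x = ~~ arc o x y,
              is_acyclic o &
              forall x y, arc o (sopp y) (sopp x) = arc o x y]
          (o \in Acyc e).
Proof.
move=> eS; rewrite inE; apply: (iffP and3P) => [[oO oA oS]|[oe oO oA oS]].
  have oP x y : if e x y then arc o x y (+) arc o y x else ~~ arc o x y.
    by have /forallP/(_ x)/forallP/(_ y) := oO.
  split=> // x y.
  - by have := oP x y; case: (e x y) => // /negbTE->.
  - by move=> xy; have := oP x y; rewrite xy; case: arc; case: arc.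
  have oS' a b : arc o a b -> arc o (sopp b) (sopp a).
    by have /forallP/(_ a)/forallP/(_ b)/implyP := oS.
  by apply/idP/idP => /oS' //; rewrite !soppK.
split=> //; last by apply/forallP=> x; apply/forallP=> y; rewrite oS implybb.
apply/forallP=> x; apply/forallP=> y; case: ifP => [/oO->|exy].
  by case: arc.
by apply/negP => /oe; rewrite exy.
Qed.

Definition restrict Y o := [set a in o | (a.1 \in Y) && (a.2 \in Y)].

(** The arcs at S point into S, those at -S point out of -S, and elsewhere the
    orientation is o: this restores S as a set of sinks. *)
Definition attach e S o :=
  [set a | if (a.1 \in pm S) || (a.2 \in pm S)
           then e a.1 a.2 && ((a.2 \in S) || (sopp a.1 \in S)) else a \in o].

Lemma arc_restrict Y o x y :
  arc (restrict Y o) x y = [&& x \in Y, y \in Y & arc o x y].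
Proof. by rewrite /arc !inE andbC andbA. Qed.

Lemma arc_attach e S o x y : arc (attach e S o) x y =
  if (x \in pm S) || (y \in pm S)
  then e x y && ((y \in S) || (sopp x \in S)) else arc o x y.
Proof. by rewrite /arc !inE. Qed.

Section Graph.
Variable e : rel (signed n).
Hypotheses (e_undirected : symmetric e) (e_symmetric : symmetric_graph e).

Lemma graphN x y : e (sopp x) (sopp y) = e x y.
Proof. by apply/idP/idP => /e_symmetric //; rewrite !soppK. Qed.

Lemma induced_undirected Y : symmetric (induced e Y).
Proof. by move=> x y; rewrite /= e_undirected andbCA. Qed.

Lemma induced_symmetric Y : symmetric_set Y -> symmetric_graph (induced e Y).
Proof. by move=> Ys x y /=; rewrite !symsetN // graphN. Qed.

Lemma restrict_Acyc Y o :
  symmetric_set Y -> o \in Acyc e -> restrict Y o \in Acyc (induced e Y).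
Proof.
move=> Ys /(AcycP _ e_undirected)[oe oO /acyclic_rankP[r rP] oS].
apply/AcycP; first exact: induced_undirected.
split=> [x y|x y /= /and3P[xY yY xy]||x y].
- by rewrite arc_restrict => /and3P[xY yY /oe xy]; apply/and3P.
- by rewrite !arc_restrict xY yY oO.
- by apply/acyclic_rankP; exists r => x y; rewrite arc_restrict => /and3P[_ _ /rP].
by rewrite !arc_restrict !symsetN // oS andbCA.
Qed.

Lemma sink_opp o x : o \in Acyc e -> is_sink o (sopp x) = is_source o x.
Proof.
move=> /(AcycP _ e_undirected)[_ _ _ oS]; apply/forallP/forallP => H y.
  by rewrite -oS H.
by rewrite -[y]soppK oS H.
Qed.

(** Acyclicity is clear from the rank that is lowest on S and highest on -S. *)
Lemma attach_Acyc S o : antisymmetric_set S -> independent e S ->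
  o \in Acyc (induced e (~: pm S)) -> attach e S o \in Acyc e.
Proof.
move=> /antisymP SA /independentP SI.
move=> /(AcycP _ (induced_undirected _))[oe oO /acyclic_rankP[r rP] oS].
have SAb x : ~~ ((x \in S) && (sopp x \in S)).
  by apply/negP => /andP[/SA/negP].
have SIb x y : e x y -> ~~ ((x \in S) && (y \in S)).
  by move=> xy; apply/negP => /andP[xS yS]; rewrite SI in xy.
have SINb x y : e x y -> ~~ ((sopp x \in S) && (sopp y \in S)).
  by rewrite -graphN; apply: SIb.
apply/AcycP => //; split=> [x y|x y xy||x y].
- rewrite arc_attach; case: ifP => _; first by case/andP.
  by move/oe => /and3P[].
- rewrite !arc_attach [(y \in _) || _]orbC e_undirected xy /=.
  case: ifP => [|/norP[xS yS]]; last by apply: oO; rewrite /= !inE -!mem_pm xS yS.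
  rewrite !mem_pm; have := SAb x; have := SAb y.
  have := SIb _ _ xy; have := SINb _ _ xy.
  by do 4!case: (_ \in S).
- apply/acyclic_rankP; pose B := \max_x r x.
  exists (fun x => if x \in S then 0%N else if sopp x \in S then B.+2 else (r x).+1).
  move=> x y; rewrite arc_attach !mem_pm.
  have rB z : (r z < B.+1)%N by rewrite ltnS; apply: leq_bigmax.
  case: ifP => [_ /andP[xy]|/norP[xS yS] /rP]; last first.
    by move: xS yS; do 4!case: (_ \in S).
  have := SAb x; have := SAb y; have := SIb _ _ xy; have := SINb _ _ xy.
  case: (x \in S); case: (sopp x \in S); case: (y \in S) => //;
    by case: (sopp y \in S) => //=; rewrite ltnS rB.
rewrite !arc_attach graphN e_undirected !mem_pm !soppK oS.
have -> : ((sopp y \in S) || (y \in S)) || ((sopp x \in S) || (x \in S)) =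
          ((x \in S) || (sopp x \in S)) || ((y \in S) || (sopp y \in S)).
  by do 4!case: (_ \in S).
by rewrite [(sopp x \in S) || (y \in S)]orbC.
Qed.

Lemma sink_attach S o x : antisymmetric_set S -> independent e S ->
  x \in S -> is_sink (attach e S o) x.
Proof.
move=> /antisymP SA /independentP SI xS; apply/forallP => y.
rewrite arc_attach mem_pm xS /=; apply/negP => /andP[xy].
by rewrite (negbTE (SA _ xS)) orbF => yS; rewrite SI in xy.
Qed.

Lemma attachK S o : o \in Acyc (induced e (~: pm S)) ->
  restrict (~: pm S) (attach e S o) = o.
Proof.
move=> /(AcycP _ (induced_undirected _))[oe _ _ _].
apply/setP=> -[x y]; rewrite -[LHS]/(arc _ x y) -[RHS]/(arc o x y).
rewrite arc_restrict arc_attach !in_setC.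
case xS: (x \in pm S) => /=.
  by apply/esym/negP => /oe /and3P[]; rewrite in_setC xS.
case yS: (y \in pm S) => //=.
by apply/esym/negP => /oe /and3P[_]; rewrite in_setC yS.
Qed.

(** An orientation in which S consists of sinks is determined by its
    restriction off pm S, since by symmetry -S then consists of sources. *)
Lemma restrictK S o : o \in Acyc e -> {in S, forall x, is_sink o x} ->
  attach e S (restrict (~: pm S) o) = o.
Proof.
move=> oA So; have oA' := oA; move: oA' => /(AcycP _ e_undirected)[oe oO _ oS].
have S1 x y : x \in S -> arc o x y = false by move/So/forallP/(_ y)/negbTE.
have S2 x y : x \in S -> e x y -> arc o y x by move=> xS /oO ->; rewrite S1.
apply/setP=> -[x y]; rewrite -[LHS]/(arc _ x y) -[RHS]/(arc o x y).
rewrite arc_attach arc_restrict !in_setC.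
case: ifP => [|/norP[-> ->] //]; rewrite !mem_pm.
have [xy|/negP nxy _] := boolP (e x y); last by apply/esym/negP => /oe.
have yx : e y x by rewrite e_undirected.
have [yS _|yS] := boolP (y \in S); first by rewrite (S2 y).
have [xS _|xS] /= := boolP (sopp x \in S).
  by rewrite -oS (S2 _ _ xS) ?graphN.
rewrite orbF => /orP[xS'|yS']; first by rewrite S1.
by rewrite -oS S1.
Qed.

End Graph.
End Orientations.

(** * Alternating count of the orientations with a set of sinks removed *)

Section Toggle.
Variable n : nat.
Implicit Types (S U W Y : {set signed n}) (e : rel (signed n)).
Implicit Types (o : {set signed n * signed n}).

Lemma antisymU1 S x : x != szero n -> sopp x \notin S ->
  antisymmetric_set (x |: S) = antisymmetric_set (S :\ x).
Proof.
move=> x0 xS; apply/antisymP/antisymP => SA y.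
  rewrite !inE => /andP[yx yS]; have := SA y.
  by rewrite !inE yS orbT => /(_ isT)/norP[_ /negbTE->]; rewrite andbF.
rewrite !inE => /orP[/eqP->|yS]; first by rewrite sopp_eq (negbTE x0).
have [->|yx] := eqVneq y x; first by rewrite sopp_eq (negbTE x0).
have := SA y; rewrite !inE yx yS => /(_ isT) /=.
rewrite negb_and negbK => /orP[/eqP xE|/negbTE->].
  by move: xS; rewrite -xE soppK yS.
by rewrite orbF; apply: contraNneq xS => <-; rewrite soppK.
Qed.

(** Each pair of opposite vertices of Y contributes the choices none, x and -x,
    hence a factor 1 - 1 - 1.  In the proof, P has one vertex from each pair,
    and the choices none and x, for x in P, cancel; only S = -P survives. *)
Lemma alternating_sum_antisym Y : symmetric_set Y ->
  \sum_(S : {set signed n} | (S \subset Y) && antisymmetric_set S)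
     (-1) ^+ #|S| = (-1) ^+ #|Y|./2 :> int.
Proof.
move=> Ys.
have [P [PA YE]] : exists P, antisymmetric_set P /\ Y :\ szero n = pm P.
  by exists (positive_half Y); rewrite positive_half_antisym pm_positive_half.
have PY : P \subset Y.
  apply/subsetP=> x xP; have : x \in pm P by rewrite mem_pm xP.
  by rewrite -YE inE => /andP[].
have oPY : oppset P \subset Y.
  by apply/subsetP=> x; rewrite inE => /(subsetP PY); rewrite symsetN.
have Y2 : #|Y|./2 = #|P|.
  by rewrite (cardsD1 (szero n) Y) YE card_pm // half_bit_double.
rewrite (partition_big (fun S => S :\: P) predT) //=.
rewrite (bigD1 (oppset P)) //= [X in _ + X]big1 ?addr0 => [|A AP].
  rewrite (big_pred1 (oppset P)) ?card_oppset ?Y2 // => S.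
  apply/andP/eqP => [[/andP[SY /antisymP SA] /eqP SP]|->]; last first.
    rewrite oPY; split; last first.
      by apply/eqP/setDidPl; rewrite disjoint_sym.
    apply/antisymP => x; rewrite !inE soppK => /(antisymP _ PA).
    by rewrite soppK.
  rewrite -SP; apply/esym/setDidPl; rewrite disjoint_subset.
  apply/subsetP => x xS; rewrite inE; apply/negP => xP.
  have : sopp x \in S :\: P by rewrite SP inE soppK.
  by rewrite inE => /andP[_]; rewrite (negbTE (SA _ xS)).
(* If A contains -P properly, the only further vertex is v_0, so that no
   antisymmetric S has A as its part outside P. *)
have [oPA|] := boolP (oppset P \subset A).
  rewrite big_pred0 // => S; apply/negP => /andP[/andP[SY SA] /eqP SP].
  move/negP: AP; apply; rewrite eqEsubset oPA andbT; apply/subsetP => x xA.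
  have : x \in S :\: P by rewrite SP.
  rewrite inE => /andP[xP xS]; have xY := subsetP SY _ xS.
  have x0 : x != szero n by apply: contraTneq xS => ->; apply: antisym0.
  have : x \in pm P by rewrite -YE !inE x0.
  by rewrite mem_pm (negbTE xP) inE.
case/subsetPn => x; rewrite inE => xP xA.
apply: (@alternating_sum_toggle _ _ (sopp x)) => S.
have xY : sopp x \in Y by apply: (subsetP PY).
have x0 : sopp x != szero n by apply: contraNneq (antisym0 PA) => <-.
rewrite subUset sub1set xY subDset (setUidPr (_ : [set _] \subset Y)) ?sub1set //.
have -> : (sopp x |: S) :\: P = (S :\ sopp x) :\: P.
  by apply/setP=> y; rewrite !inE; case: eqVneq => // ->; rewrite xP.
case: eqP => [SP|]; rewrite ?andbF // !andbT antisymU1 //.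
rewrite soppK; apply/negP => xS; case/negP: xA.
rewrite -SP !inE xS andbT; have := antisymP _ PA _ xP; rewrite soppK => ->.
by rewrite eq_sym sopp_eq; apply: contraNneq x0 => ->; rewrite sopp0.
Qed.

Definition sinks o := [set x | is_sink o x].

(** Restriction off pm S and [attach] are mutually inverse. *)
Lemma card_Acyc_remove e S :
  symmetric e -> symmetric_graph e -> antisymmetric_set S -> independent e S ->
  #|Acyc (induced e (~: pm S))| = #|[set o in Acyc e | S \subset sinks o]|.
Proof.
move=> eU eS SA SI; set B := [set o in _ | _].
have inB o : o \in B -> o \in Acyc e /\ {in S, forall x, is_sink o x}.
  rewrite inE => /andP[oA /subsetP oS]; split=> // x /oS; by rewrite inE.
rewrite -(card_in_imset (f := restrict (~: pm S)) (D := B)); last first.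
  move=> o1 o2 /inB[o1A o1S] /inB[o2A o2S] E.
  by rewrite -(restrictK eU eS o1A o1S) E restrictK.
congr #|pred_of_set _|; apply/setP=> o; apply/idP/imsetP => [oA|[o' /inB[oA _] ->]].
  exists (attach e S o); last by rewrite attachK.
  rewrite inE attach_Acyc //=; apply/subsetP => x xS.
  by rewrite inE sink_attach.
by apply: restrict_Acyc => //; apply: symmetric_set_forall => x; rewrite !inE soppK orbC.
Qed.

Lemma Acyc_edgeless e : (forall x y, e x y = false) -> Acyc e = [set set0].
Proof.
move=> e0; apply/setP=> o; rewrite in_set1.
apply/(AcycP o (_ : symmetric e))/eqP => [x y|[oe _ _ _]|->]; first by rewrite !e0.
  by apply/setP=> -[x y]; rewrite inE; apply/negP => /oe; rewrite e0.
split=> [x y|x y|| x y]; rewrite /arc ?inE ?e0 //.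
by apply/acyclic_rankP; exists (fun=> 0%N) => x y; rewrite /arc inE.
Qed.

(** The end of an edge of least rank is a sink. *)
Lemma exists_sink e o x y : symmetric e -> o \in Acyc e -> e x y ->
  exists2 z, is_sink o z & exists t, e z t.
Proof.
move=> eU /(AcycP _ eU)[oe _ /acyclic_rankP[r rP] _] xy.
pose N := [pred z | [exists t, e z t]].
have Nx : N x by apply/existsP; exists y.
case: (arg_minnP r Nx) => z /existsP[t zt] zmin; exists z; last by exists t.
apply/forallP => u; apply/negP => zu; have := rP _ _ zu.
by rewrite ltnNge zmin //; apply/existsP; exists z; rewrite eU oe.
Qed.

(** The left side counts, with sign (-1)^|S|, the pairs of an orientation of the
    graph on Y and a set S of its sinks.  If there is an edge, some sink z lies
    on an edge; then -z is not a sink, so z can be freely added to or removed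
    from S, and everything cancels. *)
Lemma alternating_sum_Acyc e Y : symmetric e -> symmetric_graph e -> symmetric_set Y ->
  \sum_(S : {set signed n} | [&& S \subset Y, antisymmetric_set S & independent e S])
     (-1) ^+ #|S| * #|Acyc (induced e (Y :\: pm S))|%:Z
  = (-1) ^+ #|Y|./2 * (independent e Y)%:R.
Proof.
move=> eU eS Ys; pose g := induced e Y.
have gU : symmetric g by apply: induced_undirected.
have gS : symmetric_graph g by apply: induced_symmetric.
transitivity (\sum_(o in Acyc g) \sum_(S : {set signed n} |
    (S \subset Y) && antisymmetric_set S && (S \subset sinks o)) (-1) ^+ #|S| : int).
  rewrite (exchange_big_dep [pred S : {set signed n} |
     [&& S \subset Y, antisymmetric_set S & independent e S]]) /=; last first.
    move=> o S oA /andP[/andP[SY ->] So]; rewrite SY /=.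
    have [_ oO _ _] := AcycP o gU oA.
    apply/independentP => x y xS yS; apply/negP => xy.
    have gxy : g x y by rewrite /g /= !(subsetP SY).
    have sinkP z t : z \in S -> arc o z t = false.
      by move/(subsetP So); rewrite inE => /forallP/(_ t)/negbTE.
    by have := oO _ _ gxy; rewrite !sinkP.
  apply: eq_bigr => S /and3P[SY SA SI].
  have -> : #|Acyc (induced e (Y :\: pm S))| = #|Acyc (induced g (~: pm S))|.
    congr #|pred_of_set _|; apply: eq_Acyc => x y; rewrite /g /= !in_setD !in_setC.
    by case: (x \in Y); case: (y \in Y); rewrite ?andbF ?andbT.
  rewrite card_Acyc_remove //; last first.
    apply/independentP => x y xS yS /=; move/independentP: SI => -> //.
    by rewrite !andbF.
  rewrite SY SA /= sumr_const -mulr_natr natz; congr (_ * Posz _).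
  by apply: eq_card => o; rewrite in_set.
have [YI|YI] := boolP (independent e Y).
  rewrite Acyc_edgeless => [|x y]; last first.
    apply/negP => /and3P[xY yY]; by move/independentP: YI => ->.
  rewrite big_set1 mulr1 -alternating_sum_antisym //; apply: eq_bigl => S.
  rewrite [S \subset sinks _](_ : _ = true) ?andbT //; apply/subsetP => x _.
  by rewrite inE; apply/forallP => y; rewrite /arc inE.
rewrite mulr0; apply: big1 => o oA.
have [x [y gxy]] : exists x y, g x y.
  move: YI; rewrite negb_forall_in => /existsP[x /andP[xY]].
  rewrite negb_forall_in => /existsP[y /andP[yY]]; rewrite negbK => xy.
  by exists x, y; apply/and3P.
have [z zo [t gzt]] := exists_sink gU oA gxy.
have zY : z \in Y by case/and3P: gzt.
have [_ oO _ oS] := AcycP o gU oA.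
have nzt : arc o t z by rewrite oO // (forallP zo).
have z0 : z != szero n.
  apply: contraTneq nzt => z0; rewrite -oS z0 sopp0 -z0.
  by have /forallP := zo.
apply: (@alternating_sum_toggle _ _ z) => S.
rewrite !subUset !sub1set zY inE zo !subDset.
rewrite (setUidPr (_ : [set z] \subset Y)) ?sub1set //.
rewrite (setUidPr (_ : [set z] \subset sinks o)) ?sub1set ?inE //=.
have [So|] := boolP (S \subset sinks o); rewrite ?andbF // !andbT.
congr (_ && _).
apply: antisymU1 => //; apply/negP => /(subsetP So).
rewrite inE => /forallP/(_ (sopp t)).
by rewrite oS nzt.
Qed.

End Toggle.

(** * Colorings, and removal of the vertices of the largest color *)

Section Colors.
Variables k l : nat.
Implicit Types c : color k l.

Definition cshift c : color k.+1 l :=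
  match c with inl a => inl (inord a.+1) | inr z => inr z end.

Definition cunshift (c : color k.+1 l) : color k l :=
  match c with inl a => inl (inord a.-1) | inr z => inr z end.

Definition ctop : color k.+1 l := inl ord_max.

Lemma cshiftK : cancel cshift cunshift.
Proof.
case=> [a|z] //=; congr inl; apply: val_inj.
by have := ltn_ord a => a_lt; rewrite /= !inordK /= ?inordK; lia.
Qed.

Lemma cunshiftK (c : color k.+1 l) :
  c != ctop -> c != copp ctop -> cshift (cunshift c) = c.
Proof.
case: c => [a|z] //=; rewrite !(inj_eq (@inl_inj _ _)) -!val_eqE /= => a1 a2.
have a_lt := ltn_ord a; congr inl; apply: val_inj.
by rewrite /= !inordK /= ?inordK; lia.
Qed.

Lemma cshift_opp c : cshift (copp c) = copp (cshift c).
Proof.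
case: c => [a|z] //=; congr inl; apply: val_inj; have a_lt := ltn_ord a.
by rewrite /= !inordK /=; lia.
Qed.

Lemma cshift0 : cshift (czero k l) = czero k.+1 l.
Proof. by congr inl; apply: val_inj; rewrite /= !inordK; lia. Qed.

Lemma cshift_top c : cshift c != ctop.
Proof.
case: c => [a|z] //=; rewrite (inj_eq (@inl_inj _ _)) -val_eqE /=.
by have a_lt := ltn_ord a; rewrite inordK; lia.
Qed.

Lemma copp_top : copp ctop != ctop.
Proof. by rewrite (inj_eq (@inl_inj _ _)) -val_eqE /=; lia. Qed.

Lemma czero_top : czero k.+1 l != ctop.
Proof. by rewrite -cshift0 cshift_top. Qed.

Lemma cshift_bot c : cshift c != copp ctop.
Proof. by rewrite -(can_eq (@coppK _ _)) coppK -cshift_opp cshift_top. Qed.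

End Colors.

Section Colorings.
Variable n : nat.
Implicit Types (S U W Y : {set signed n}) (e : rel (signed n)).

(** Colorings of the graph induced on U.  The deleted vertices are kept in the
    index set with color 0, so that the graphs obtained by deletions all live
    on the same vertices and [constraints_poly] applies to them. *)
Definition colorings e U k l :=
  [set f : {ffun signed n -> color k l} |
    [&& is_signed_map f, [forall x, (x \notin U) ==> (f x == czero k l)]
      & [forall x, forall y, induced e U x y ==> (f x != f y)]]].

Lemma coloringsP e U k l (f : {ffun signed n -> color k l}) :
  reflect [/\ f (szero n) = czero k l, forall x, f (sopp x) = copp (f x),
              forall x, x \notin U -> f x = czero k l &
              forall x y, x \in U -> y \in U -> e x y -> f x <> f y]
          (f \in colorings e U k l).
Proof.
rewrite inE; apply: (iffP and3P) => [[/is_signed_mapP[f0 fN] fU fE]|[f0 fN fU fE]].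
  split=> // [x xU|x y xU yU xy].
    by have /forallP/(_ x)/implyP/(_ xU)/eqP := fU.
  apply/eqP; have /forallP/(_ x)/forallP/(_ y)/implyP := fE.
  by apply; apply/and3P.
split; first exact/is_signed_mapP.
  by apply/forallP=> x; apply/implyP=> /fU->.
apply/forallP=> x; apply/forallP=> y; apply/implyP=> /and3P[xU yU xy].
by apply/eqP; apply: fE.
Qed.

Lemma coloring_poly_exists e U : {chi : {poly {poly int}} |
  forall k l : nat, (0 < l)%N -> chi.[k%:Z, l%:Z] = #|colorings e U k l|%:Z}.
Proof.
have [chi chiP] := constraints_poly [seq p <- enum predT | induced e U p.1 p.2]
                                    [seq (x, szero n) | x <- enum (~: U)].
exists chi => k l l_gt0; rewrite chiP //; congr (Posz #|pred_of_set _|).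
apply/setP=> f; rewrite inE; apply/and3P/coloringsP => [[fS fU fE]|[f0 fN fU fE]].
  have [f0 fN] := is_signed_mapP _ fS.
  split=> // [x xU|x y xU yU xy].
    have /allP/(_ (x, szero n)) := fU; rewrite -f0 => H; apply/eqP/H.
    by apply: map_f; rewrite mem_enum inE.
  have /allP/(_ (x, y)) := fE; rewrite mem_filter mem_enum /= xU yU xy => H.
  exact/eqP/H.
split; first exact/is_signed_mapP.
  by apply/allP=> _ /mapP[x xU ->] /=; rewrite f0 fU //; rewrite mem_enum inE in xU.
apply/allP=> -[x y]; rewrite mem_filter => /andP[/and3P[xU yU xy] _].
by apply/eqP/fE.
Qed.

Definition coloring_poly e U := sval (coloring_poly_exists e U).

Lemma coloring_polyP e U k l : (0 < l)%N ->
  (coloring_poly e U).[k%:Z, l%:Z] = #|colorings e U k l|%:Z.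
Proof. exact: svalP (coloring_poly_exists e U) k l. Qed.

Lemma coloring_polyT e : coloring_poly e setT = bichromatic_poly e.
Proof.
apply: (@bichromatic_poly_unique n e); last exact: bichromatic_polyP.
move=> k l _ l_gt0; rewrite coloring_polyP //; congr (Posz #|pred_of_set _|).
apply/setP=> f; rewrite !inE; congr (_ && _).
have -> : [forall x, (x \notin [set: signed n]) ==> (f x == czero k l)].
  by apply/forallP=> x; rewrite in_setT.
by apply: eq_forallb => x; apply: eq_forallb => y; rewrite /= !in_setT.
Qed.

Definition lift_coloring S k l (f : {ffun signed n -> color k l}) :=
  [ffun x => if x \in S then ctop k l
             else if sopp x \in S then copp (ctop k l) else cshift (f x)].

Section Succ.
Variables (e : rel (signed n)) (U : {set signed n}) (k l : nat).
Hypotheses (e_symmetric : symmetric_graph e) (Us : symmetric_set U).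

Let top_class (g : {ffun signed n -> color k.+1 l}) := g @^-1: [set ctop k l].

Let mem_top g x : (x \in top_class g) = (g x == ctop k l).
Proof. by rewrite !inE. Qed.

Lemma top_class_admissible g : g \in colorings e U k.+1 l ->
  [/\ top_class g \subset U, antisymmetric_set (top_class g) &
      independent e (top_class g)].
Proof.
move=> /coloringsP[_ gN gU gE]; have TU : top_class g \subset U.
  apply/subsetP=> x; rewrite mem_top => /eqP gx; apply: contraT => /gU.
  by move/eqP; rewrite gx eq_sym (negbTE (czero_top k l)).
split=> //; first apply/antisymP=> x.
  by rewrite !mem_top gN => /eqP->; apply: copp_top.
apply/independentP=> x y xT yT; apply/negP => xy.
apply: (gE x y); rewrite ?(subsetP TU) //.
by move: xT yT; rewrite !mem_top => /eqP-> /eqP->.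
Qed.

(** Once the class S of the color k+1 is fixed, that of -(k+1) is -S, and the
    remaining vertices carry a coloring with colors up to k. *)
Lemma card_top_class S : S \subset U -> antisymmetric_set S -> independent e S ->
  #|[set g in colorings e U k.+1 l | top_class g == S]| =
  #|colorings e (U :\: pm S) k l|.
Proof.
move=> SU SA SI; have /antisymP SN := SA; have S0 := antisym0 SA.
rewrite -(card_in_imset (f := @lift_coloring S k l)); last first.
  move=> f1 f2 /coloringsP[_ _ f1U _] /coloringsP[_ _ f2U _] /ffunP E.
  apply/ffunP=> x; have [xS|] := boolP (x \in pm S).
    by rewrite f1U ?f2U // inE xS.
  rewrite mem_pm => /norP[xS xS']; have := E x.
  by rewrite !ffunE (negbTE xS) (negbTE xS') => /(can_inj (@cshiftK k l)).
congr #|pred_of_set _|; apply/setP=> g; rewrite in_set.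
apply/andP/imsetP => [[gC /eqP gS]|[f /coloringsP[f0 fN fU fE] ->]].
  have [g0 gN gU gE] := coloringsP _ _ _ gC.
  have gtop x : x \notin S -> g x != ctop k l by rewrite -gS mem_top.
  have gtop' x : x \in S -> g x = ctop k l by rewrite -gS mem_top => /eqP.
  have gbot x : sopp x \notin S -> g x != copp (ctop k l).
    by rewrite -(can_eq (@coppK _ _)) coppK -gN; apply: gtop.
  pose f := [ffun x => if x \in pm S then czero k l else cunshift (g x)].
  have shf x : x \notin pm S -> cshift (f x) = g x.
    move=> xS; rewrite ffunE (negbTE xS); move: xS; rewrite mem_pm => /norP[xS xS'].
    by rewrite cunshiftK ?gtop ?gbot.
  have c_inj := can_inj (@cshiftK k l).
  have pmN x : (sopp x \in pm S) = (x \in pm S) by apply/symsetN/pm_sym.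
  exists f; last first.
    apply/ffunP=> x; rewrite ffunE; case: ifPn => [/gtop'//|xS].
    case: ifPn => [/gtop'|xS']; first by rewrite gN => <-; rewrite coppK.
    by rewrite shf // mem_pm negb_or xS.
  apply/coloringsP; split=> [|x|x|x y].
  - by apply: c_inj; rewrite shf ?g0 ?cshift0 // mem_pm sopp0 orbb.
  - have [xS|xS] := boolP (x \in pm S); first by rewrite !ffunE pmN xS copp0.
    by apply: c_inj; rewrite cshift_opp !shf ?pmN ?gN.
  - rewrite inE negb_and negbK; have [xS _|xS /= xU] := boolP (x \in pm S).
      by rewrite ffunE xS.
    by apply: c_inj; rewrite shf // gU // cshift0.
  rewrite !in_setD => /andP[xS xU] /andP[yS yU] xy fxy.
  by apply: (gE x y) => //; rewrite -!shf ?fxy.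
split; last first.
  apply/eqP/setP=> x; rewrite mem_top ffunE; case: ifPn => [|xS]; rewrite ?eqxx //.
  by case: ifP => _; apply/negbTE; rewrite ?copp_top ?cshift_top.
apply/coloringsP; split=> [|x|x xU|x y xU yU xy].
- by rewrite ffunE sopp0 (negbTE S0) f0 cshift0.
- rewrite !ffunE soppK; case: ifPn => [xS|xS].
    by case: ifPn => [/SN|_]; [rewrite xS|rewrite coppK].
  by case: ifPn => xS'; rewrite ?coppK // fN cshift_opp.
- have xS : x \notin S by apply: contra xU => /(subsetP SU).
  have xS' : sopp x \notin S by apply: contra xU => /(subsetP SU); rewrite symsetN.
  by rewrite ffunE (negbTE xS) (negbTE xS') fU ?cshift0 // inE negb_and xU orbT.
have tb : ctop k l <> copp (ctop k l) by apply/eqP; rewrite eq_sym copp_top.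
have tc c : ctop k l <> cshift c by apply/eqP; rewrite eq_sym cshift_top.
have bc c : copp (ctop k l) <> cshift c by apply/eqP; rewrite eq_sym cshift_bot.
rewrite !ffunE; have [xS|xS] := boolP (x \in S); have [yS|yS] := boolP (y \in S).
- by move/independentP: SI => /(_ _ _ xS yS); rewrite xy.
- by case: ifP => _; [apply: tb|apply: tc].
- by case: ifP => _ /esym; [apply: tb|apply: tc].
have [xS'|xS'] := boolP (sopp x \in S); have [yS'|yS'] := boolP (sopp y \in S).
- by move/independentP: SI => /(_ _ _ xS' yS'); rewrite e_symmetric.
- exact: bc.
- by move/esym; apply: bc.
move/(can_inj (@cshiftK k l)).
by apply: fE; rewrite // inE mem_pm negb_or ?xS ?yS ?xU ?yU ?xS' ?yS'.
Qed.

Lemma card_colorings_succ : #|colorings e U k.+1 l| =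
  (\sum_(S : {set signed n} |
      [&& S \subset U, antisymmetric_set S & independent e S])
   #|colorings e (U :\: pm S) k l|)%N.
Proof.
rewrite -sum1_card (partition_big top_class [pred S : {set signed n} |
  [&& S \subset U, antisymmetric_set S & independent e S]]) /=; last first.
  by move=> g /top_class_admissible[-> -> ->].
apply: eq_bigr => S /and3P[SU SA SI]; rewrite -card_top_class // -sum1_card.
by apply: eq_bigl => g; rewrite [in RHS]in_set.
Qed.

End Succ.

Definition admissible e U W :=
  [&& W \subset U, symmetric_set W, szero n \notin W & independent e W].

(** For k = 0 and l = 2 all colors are their own opposites, so a coloring is a
    partition into two symmetric independent classes; W is that of 0_1. *)
Lemma card_colorings0 e U : symmetric_set U ->
  #|colorings e U 0 2|%:Z =
  \sum_(W | admissible e U W) (independent e (U :\: W))%:R.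
Proof.
move=> Us; pose one : color 0 2 := inr ord0.
(* The only colors are 0 and 0_1. *)
have c2 (c : color 0 2) : c = if c == czero 0 2 then czero 0 2 else one.
  case: c => [a|z]; last by rewrite /= [z]ord1.
  have -> : a = szero 0 by apply: val_inj; have := ltn_ord a; rewrite /= inordK //; lia.
  by rewrite eqxx.
have copp1 (c : color 0 2) : copp c = c by rewrite [c]c2; case: ifP => //; rewrite copp0.
pose phi W := [ffun x : signed n => if x \in W then one else czero 0 2].
have one0 : one <> czero 0 2 by [].
pose A := [set W | admissible e U W && independent e (U :\: W)].
transitivity (#|A|%:Z); last first.
  rewrite [RHS](eq_bigr (fun W => if independent e (U :\: W) then 1 else 0)).
    rewrite -big_mkcondr -natz -sumr_const; apply: eq_bigl => W.
    by rewrite [LHS]in_set.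
  by move=> W _; case: independent.
rewrite -(card_in_imset (f := phi) (D := A)); last first.
  move=> W1 W2 _ _ /ffunP E; apply/setP=> x; have := E x; rewrite !ffunE.
  by do 2!case: (x \in _).
congr (Posz #|pred_of_set _|); apply/setP=> f.
apply/coloringsP/imsetP => [[f0 fN fU fE]|[W]].
  pose W := [set x | f x != czero 0 2].
  exists W; last by apply/ffunP=> x; rewrite ffunE inE [LHS]c2; case: eqP.
  have WU : W \subset U.
    by apply/subsetP=> x; rewrite inE; apply: contraR => /fU ->.
  have fW x : x \in W -> f x = one.
    by rewrite inE => /negbTE fx; rewrite [LHS]c2 fx.
  have fW0 x : x \notin W -> f x = czero 0 2 by rewrite inE negbK => /eqP.
  rewrite inE; apply/andP; split; first apply/and4P; first split=> //.
  - by apply: symmetric_set_forall => x; rewrite !inE fN copp1.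
  - by rewrite inE f0 eqxx.
  - apply/independentP => x y xW yW; apply/negP => xy.
    by apply: (fE x y); rewrite ?(subsetP WU) // !fW.
  apply/independentP => x y; rewrite !in_setD => /andP[xW xU] /andP[yW yU].
  by apply/negP => xy; apply: (fE x y); rewrite // !fW0.
rewrite inE => /andP[/and4P[/subsetP WU Ws W0 /independentP WI] /independentP UI] ->.
split=> [|x|x xU|x y xU yU xy].
- by rewrite ffunE (negbTE W0).
- by rewrite copp1 !ffunE symsetN.
- by rewrite ffunE; case: ifP => // /WU; rewrite (negbTE xU).
rewrite !ffunE; case: ifPn => xW; case: ifPn => yW //.
  by rewrite WI in xy.
by rewrite UI ?inE ?xW ?yW in xy.
Qed.
End Colorings.

(** * The value of the chromatic polynomial at k = -1, l = 2 *)

Lemma poly_eq_nat (p q : {poly int}) :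
  (forall k : nat, p.[k%:Z] = q.[k%:Z]) -> p = q.
Proof.
move=> pq; apply/eqP; rewrite -subr_eq0; apply: contraTT isT => r_neq0.
have := @max_poly_roots _ _ [seq m%:Z | m <- iota 0 (size (p - q))] r_neq0.
rewrite map_inj_uniq ?iota_uniq; last by move=> a b [].
rewrite size_map size_iota ltnn; apply=> //.
by apply/allP=> _ /mapP[m _ ->]; rewrite /root hornerD hornerN pq subrr.
Qed.

Section Evaluation.
Variable n : nat.
Implicit Types (S U W Y : {set signed n}) (e : rel (signed n)).

(** [card_colorings_succ] at k = -1: both sides are polynomials in k that agree
    at all natural numbers. *)
Lemma sum_coloring_poly e U : symmetric_graph e -> symmetric_set U ->
  \sum_(S : {set signed n} |
      [&& S \subset U, antisymmetric_set S & independent e S])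
    (coloring_poly e (U :\: pm S)).[-1, 2] = #|colorings e U 0 2|%:Z.
Proof.
move=> eS Us; pose q Y : {poly int} := map_poly (horner_eval 2) (coloring_poly e Y).
have qE Y x : (q Y).[x] = (coloring_poly e Y).[x%:P].[2].
  have -> : x = horner_eval 2 x%:P by rewrite /horner_eval hornerC.
  by rewrite horner_map /= /horner_eval !hornerC.
have qN Y (k : nat) : (q Y).[k%:Z] = #|colorings e Y k 2|%:Z.
  by rewrite qE -(@coloring_polyP n e Y k 2).
rewrite -(qN U 0); under eq_bigr do rewrite -qE; rewrite -horner_sum.
have -> : \sum_(S : {set signed n} |
    [&& S \subset U, antisymmetric_set S & independent e S]) q (U :\: pm S) =
    q U \Po ('X + 1).
  apply: poly_eq_nat => k; rewrite horner_comp !hornerE horner_sum.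
  have -> : k%:Z + 1 = k.+1%:Z by rewrite -addn1 PoszD.
  rewrite qN card_colorings_succ // -[RHS]natz natr_sum.
  by apply: eq_bigr => S _; rewrite qN natz.
by rewrite horner_comp !hornerE.
Qed.

(** The Euler characteristic of the cubical complex of flips: W together with an
    orientation of the rest is a cube of dimension |W|/2. *)
Definition cube_sum e U : int :=
  \sum_(W | admissible e U W) (-1) ^+ #|W|./2 * #|Acyc (induced e (U :\: W))|%:Z.

Lemma half_card_pm U S : symmetric_set U -> S \subset U -> antisymmetric_set S ->
  #|U|./2 = (#|U :\: pm S|./2 + #|S|)%N.
Proof.
move=> Us SU SA.
have pmU : pm S \subset U.
  apply/subsetP=> x; rewrite mem_pm => /orP[] /(subsetP SU) //.
  by rewrite symsetN.
have := cardsID (pm S) U; rewrite (setIidPr pmU) card_pm // => <-.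
by rewrite halfD odd_double doubleK add0n addnC.
Qed.

Lemma pm_admissible e U W : admissible e U W ->
  W = pm (positive_half W) /\ positive_half W \subset U.
Proof.
case/and4P => WU Ws W0 _; split.
  by rewrite pm_positive_half //; apply/esym/setDidPl; rewrite disjoint_sym disjoints1.
by apply: subset_trans WU; apply/subsetP=> x; rewrite inE => /andP[].
Qed.

Lemma half_card_admissible e U W : symmetric_set U -> admissible e U W ->
  #|U|./2 = (#|U :\: W|./2 + #|W|./2)%N.
Proof.
move=> Us /pm_admissible[{2 3}-> WU]; have WA := positive_half_antisym W.
by rewrite card_pm // doubleK -half_card_pm.
Qed.

(** The same recursion as in [sum_coloring_poly].  The sets S and W are disjoint,
    so W can be chosen first, and [alternating_sum_Acyc] evaluates the sum
    over S in the graph without W. *)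
Lemma signed_sum_cube_sum e U : symmetric e -> symmetric_graph e ->
  symmetric_set U ->
  \sum_(S : {set signed n} |
      [&& S \subset U, antisymmetric_set S & independent e S])
    (-1) ^+ #|U :\: pm S|./2 * cube_sum e (U :\: pm S) = #|colorings e U 0 2|%:Z.
Proof.
move=> eU eS Us; rewrite card_colorings0 //.
transitivity (\sum_(S : {set signed n} |
      [&& S \subset U, antisymmetric_set S & independent e S])
    \sum_(W | admissible e (U :\: pm S) W)
     (-1) ^+ (#|U :\: W|./2 + #|S|) * #|Acyc (induced e (U :\: W :\: pm S))|%:Z).
  apply: eq_bigr => S /and3P[SU SA SI]; rewrite mulr_sumr.
  apply: eq_bigr => W WP; rewrite mulrA -exprD.
  have -> : U :\: W :\: pm S = U :\: pm S :\: W by rewrite !setDDl setUC.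
  have Uss : symmetric_set (U :\: pm S) by rewrite symsetD ?pm_sym.
  have WP' : admissible e U W.
    case/and4P: WP => WU Ws W0 WI; apply/and4P; split=> //.
    exact: subset_trans WU (subsetDl _ _).
  congr (_ * _).
  (* u, a, b, c stand for the numbers of pairs in U, U - pm S, U - pm S - W and
     U - W, while s and w are the numbers of pairs in pm S and in W. *)
  have parity (u a s b c w : nat) :
      u = (a + s)%N -> a = (b + w)%N -> u = (c + w)%N ->
      (-1) ^+ (a + w) = (-1) ^+ (c + s) :> int.
    move=> uE aE uE'; rewrite -[RHS]signr_odd -[LHS]signr_odd.
    by congr (_ ^+ nat_of_bool _); lia.
  apply: parity (half_card_pm Us SU SA) (half_card_admissible Uss WP) _.
  exact: half_card_admissible Us WP'.
rewrite (exchange_big_dep (admissible e U)) /=; last first.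
  move=> S W /and3P[SU _ _] /and4P[WU Ws W0 WI]; apply/and4P; split=> //.
  exact: subset_trans WU (subsetDl _ _).
apply: eq_bigr => W /and4P[WU Ws W0 WI].
have UWs : symmetric_set (U :\: W) by rewrite symsetD.
rewrite -[RHS]mul1r -[X in _ = X * _](sqrr_sign int #|U :\: W|./2) expr2 -mulrA.
rewrite -alternating_sum_Acyc // mulr_sumr.
apply: eq_big => [S|S _]; last by rewrite exprD mulrA.
rewrite /admissible /= Ws W0 WI !andbT !subsetD WU /=.
have -> : [disjoint W & pm S] = [disjoint S & W].
  rewrite !disjoint_subset; apply/subsetP/subsetP => H x.
    by move=> xS; rewrite inE; apply/negP => /H; rewrite inE mem_pm xS.
  move=> xW; rewrite inE mem_pm; apply/norP; split; apply/negP => /H.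
    by rewrite inE xW.
  by rewrite inE symsetN // xW.
by rewrite -!andbA [_ && (antisymmetric_set S && _)]andbC -!andbA; do !bool_congr.
Qed.

Lemma coloring_poly_cube_sum e U : symmetric e -> symmetric_graph e ->
  symmetric_set U ->
  (coloring_poly e U).[-1, 2] = (-1) ^+ #|U|./2 * cube_sum e U.
Proof.
move=> eU eS; have [m] := ubnP #|U|; elim: m U => // m IHm U Um Us.
have := sum_coloring_poly eS Us; rewrite -signed_sum_cube_sum //.
have PS0 : [&& set0 \subset U, @antisymmetric_set n set0 & independent e set0].
  rewrite sub0set /=; apply/andP; split; first by apply/antisymP=> x; rewrite inE.
  by apply/independentP=> x y; rewrite inE.
rewrite (bigD1 set0) //= [in RHS](bigD1 set0) //=.
have -> : U :\: pm set0 = U by apply/setP=> x; rewrite !inE.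
rewrite (eq_bigr (fun S => (-1) ^+ #|U :\: pm S|./2 * cube_sum e (U :\: pm S))).
  exact: addIr.
move=> S /andP[/and3P[SU SA SI] S0].
have /set0Pn[x xS] := S0.
apply: IHm; last by rewrite symsetD ?pm_sym.
rewrite -ltnS; apply: leq_trans Um; rewrite ltnS.
apply: proper_card; apply/properP; split; first exact: subsetDl.
by exists x; rewrite ?(subsetP SU) // inE mem_pm xS.
Qed.

End Evaluation.

(** * Heights on a flip class, and its Euler characteristic *)

Section Heights.
Variables (n : nat) (e : rel (signed n)).
Hypotheses (e_undirected : symmetric e) (e_loopless : irreflexive e)
  (e_symmetric : symmetric_graph e) (e_weakly_connected : weakly_connected e).
Implicit Types (S W : {set signed n}) (o b : {set signed n * signed n}).
Implicit Types (h : {ffun signed n -> int}).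

(** h x is the number of times that x is flipped from source to sink, minus the
    number of times that it is flipped back, on a way from o to o': between
    flips at one end of an edge there is one at the other end. *)
Definition height o o' h :=
  [forall x, h (sopp x) == - h x] &&
  [forall x, forall y, arc o x y ==> (h x - h y == (arc o' y x)%:Z)].

Lemma heightP o o' h :
  reflect ((forall x, h (sopp x) = - h x) /\
           (forall x y, arc o x y -> h x - h y = (arc o' y x)%:Z))
          (height o o' h).
Proof.
apply: (iffP andP) => [[/forallP hN /forallP hA]|[hN hA]].
  split=> [x|x y xy]; first exact/eqP.
  by have /forallP/(_ y)/implyP/(_ xy)/eqP := hA x.
split; first by apply/forallP=> x; rewrite hN.
by apply/forallP=> x; apply/forallP=> y; apply/implyP=> /hA->.
Qed.

Lemma height_refl o : o \in Acyc e -> height o o [ffun=> 0].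
Proof.
move=> /(AcycP _ e_undirected)[oe oO _ _]; apply/heightP.
by split=> [x|x y xy]; rewrite !ffunE ?oppr0 // oO ?oe // xy.
Qed.

Lemma height_trans o o' o'' h h' :
  o \in Acyc e -> o' \in Acyc e -> o'' \in Acyc e ->
  height o o' h -> height o' o'' h' -> height o o'' [ffun x => h x + h' x].
Proof.
move=> /(AcycP _ e_undirected)[oe oO _ _] /(AcycP _ e_undirected)[oe' oO' _ _].
move=> /(AcycP _ e_undirected)[oe'' oO'' _ _] /heightP[hN hA] /heightP[hN' hA'].
apply/heightP; split=> [x|x y xy]; rewrite !ffunE; first by rewrite hN hN' opprD.
have exy := oe _ _ xy; have E := hA _ _ xy; have := oO' _ _ exy.
case xy' : (arc o' x y) => /= yx'; rewrite yx' /= in E.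
  by have := hA' _ _ xy'; lia.
rewrite oO'' //; have := hA' _ _ yx'.
by case: (arc o'' x y) => /=; lia.
Qed.

Lemma height_sym o o' h : o \in Acyc e -> o' \in Acyc e ->
  height o o' h -> height o' o [ffun x => - h x].
Proof.
move=> /(AcycP _ e_undirected)[oe oO _ _] /(AcycP _ e_undirected)[oe' oO' _ _].
move=> /heightP[hN hA]; apply/heightP.
split=> [x|x y xy']; rewrite !ffunE; first by rewrite hN.
have exy := oe' _ _ xy'; have := oO' _ _ exy; rewrite xy' /= => yx'.
case xy : (arc o x y).
  by have := hA _ _ xy; rewrite oO // xy yx' /=; lia.
have yx : arc o y x by rewrite oO // xy.
by have := hA _ _ yx; rewrite yx xy' /=; lia.
Qed.

(** The difference of two heights is constant along edges, hence equal at x and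
    -x, where it takes opposite values. *)
Lemma height_unique o o' h h' : o \in Acyc e ->
  height o o' h -> height o o' h' -> h = h'.
Proof.
move=> /(AcycP _ e_undirected)[oe oO _ _] /heightP[hN hA] /heightP[hN' hA'].
have d_edge x y : e x y -> h x - h' x = h y - h' y.
  move=> exy; case xy : (arc o x y).
    by have := hA _ _ xy; have := hA' _ _ xy; lia.
  have yx : arc o y x by rewrite oO // xy.
  by have := hA _ _ yx; have := hA' _ _ yx; lia.
have d_connect x y : connect e x y -> h x - h' x = h y - h' y.
  case/connectP=> s; elim: s x => [x _ -> //|z s IHs x /= /andP[/d_edge-> zs]].
  exact: IHs.
apply/ffunP=> x; suff : h x - h' x = h (sopp x) - h' (sopp x).
  by rewrite hN hN' => E; have -> : h x = h' x :> int by lia.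
have [->|x0] := eqVneq x (szero n); first by rewrite sopp0.
exact/d_connect/e_weakly_connected.
Qed.

Lemma height0_eq o o' : o \in Acyc e -> o' \in Acyc e ->
  height o o' [ffun=> 0] -> o = o'.
Proof.
move=> /(AcycP _ e_undirected)[oe oO _ _] /(AcycP _ e_undirected)[oe' oO' _ _].
move=> /heightP[_ hA].
have sub x y : arc o x y -> arc o' x y.
  move=> xy; have := hA _ _ xy; rewrite !ffunE oO' ?oe //.
  by case: arc.
apply/setP=> -[x y]; rewrite -[LHS]/(arc o x y) -[RHS]/(arc o' x y).
apply/idP/idP => [/sub //|xy']; apply: contraT => xy.
have : arc o y x by rewrite oO ?oe'.
by move/sub; rewrite oO' ?xy' // oe'.
Qed.

(** Two orientations that agree off pm S and have pm S made of sinks and sources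
    differ by the flips of the vertices that are sinks in only one of them. *)
Lemma height_attach S S' o o' :
  o \in Acyc e -> o' \in Acyc e -> antisymmetric_set S -> antisymmetric_set S' ->
  pm S = pm S' -> independent e (pm S) ->
  {in S, forall x, is_sink o x} -> {in S', forall x, is_sink o' x} ->
  restrict (~: pm S) o = restrict (~: pm S') o' ->
  height o o' [ffun x => (x \in S')%:Z - (x \in S)%:Z].
Proof.
move=> oA oA' SA SA' SE /independentP SI So So' oE.
have [oe oO _ _] := AcycP _ e_undirected oA.
have pm_opp S0 x : antisymmetric_set S0 -> x \in pm S0 -> (sopp x \in S0) = (x \notin S0).
  move=> /antisymP S0A; rewrite mem_pm; case: (boolP (x \in S0)) => [/S0A/negbTE->|] //.
have out S0 x : x \notin pm S0 -> (x \in S0 = false) * (sopp x \in S0 = false).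
  by rewrite mem_pm => /norP[/negbTE-> /negbTE->].
apply/heightP; split=> [x|x y xy]; rewrite !ffunE.
  have [xS|xS] := boolP (x \in pm S).
    have xS' : x \in pm S' by rewrite -SE.
    by rewrite (pm_opp S) // (pm_opp S') //; do 2!case: (x \in _).
  have xS' : x \notin pm S' by rewrite -SE.
  by rewrite !(out S x xS) !(out S' x xS').
have exy := oe _ _ xy; have eyx : e y x by rewrite e_undirected.
rewrite -(restrictK e_undirected e_symmetric oA' So') arc_attach eyx -oE -SE.
rewrite -(restrictK e_undirected e_symmetric oA So) arc_attach exy in xy.
have [xS|xS] := boolP (x \in pm S).
  have yS : y \notin pm S by apply/negP => /(SI _ _ xS); rewrite exy.
  have xS' : x \in pm S' by rewrite -SE.
  have yS' : y \notin pm S' by rewrite -SE.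
  move: xy; rewrite xS orbT /= !(out S y yS) !(out S' y yS') (pm_opp S x SA xS) orbF /=.
  by move=> /negbTE->; case: (x \in S').
have xS' : x \notin pm S' by rewrite -SE.
move: xy; rewrite (negbTE xS) orbF /= !(out S x xS) !(out S' x xS').
have [yS|yS] /= := boolP (y \in pm S).
  have yS' : y \in pm S' by rewrite -SE.
  by rewrite orbF (pm_opp S' y SA' yS') => ->; case: (y \in S').
have yS' : y \notin pm S' by rewrite -SE.
rewrite !(out S y yS) !(out S' y yS') !arc_restrict => /and3P[-> -> xy] /=.
by rewrite oO // xy.
Qed.

Lemma flip_opp x o : flip (sopp x) o = flip x o.
Proof.
apply/setP=> -[u v]; rewrite !inE soppK /=.
suff -> : [|| u == sopp x, u == x, v == sopp x | v == x] =
          [|| u == x, u == sopp x, v == x | v == sopp x] by [].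
by do 4!case: (_ == _).
Qed.

(** After the flip the source x is a sink, so that a flip is an instance of
    [attach] and inherits its properties. *)
Lemma flip_attach x o : o \in Acyc e -> x != szero n -> ~~ e x (sopp x) ->
  is_source o x ->
  [/\ antisymmetric_set [set x], independent e (pm [set x]) &
      flip x o = attach e [set x] (restrict (~: pm [set x]) o)].
Proof.
move=> oA x0 xx /forallP xo; have [oe oO _ oS] := AcycP _ e_undirected oA.
have pmE y : (y \in pm [set x]) = (y == x) || (y == sopp x).
  by rewrite mem_pm !in_set1 (inv_eq (@soppK n)).
have SI : independent e (pm [set x]).
  apply/independentP=> y z; rewrite !pmE.
  move=> /orP[] /eqP-> /orP[] /eqP->; rewrite ?e_loopless ?(negbTE xx) //.
  by rewrite e_undirected (negbTE xx).
split=> //.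
  by apply/antisymP => y /set1P->; rewrite inE sopp_eq.
have sinkN y : arc o (sopp x) y = false by rewrite -[y]soppK oS (negbTE (xo _)).
apply/setP=> -[u v]; rewrite -[RHS]/(arc _ u v) arc_attach arc_restrict inE /=.
rewrite !in_setC !pmE -!orbA.
case: ifPn => [uv|/norP[ux /norP[ux' /norP[vx vx']]]]; last first.
  by rewrite (negbTE ux) (negbTE ux') (negbTE vx) (negbTE vx').
rewrite -[LHS]/(arc o v u) !in_set1 (inv_eq (@soppK n)).
have [euv|neuv] := boolP (e u v); last first.
  by apply/negbTE; apply: contra neuv => /oe; rewrite e_undirected.
case: (eqVneq v x) => [vx|vx] /=.
  by rewrite vx in euv *; rewrite oO // (negbTE (xo _)).
have [ux|ux] := eqVneq u (sopp x).
  by rewrite ux in euv *; rewrite oO // sinkN.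
move: uv; rewrite (negbTE vx) (negbTE ux) /= => /orP[/eqP->|/eqP->].
  by apply/negbTE.
exact: sinkN.
Qed.

Lemma flip_source_height x o : o \in Acyc e -> x != szero n ->
  ~~ e x (sopp x) -> is_source o x ->
  flip x o \in Acyc e /\
  height o (flip x o) [ffun y => (y == x)%:Z - (y == sopp x)%:Z].
Proof.
move=> oA x0 xx xo; have [SA SI fE] := flip_attach oA x0 xx xo.
have pmN : pm [set sopp x] = pm [set x].
  by apply/setP=> y; rewrite !mem_pm !in_set1 !(inv_eq (@soppK n)) soppK orbC.
have SAN : antisymmetric_set [set sopp x].
  by apply/antisymP => y /set1P->; rewrite inE sopp_eq (inv_eq (@soppK n)) sopp0.
have SI1 : independent e [set x].
  by apply/independentP=> y z /set1P-> /set1P->.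
have rA : restrict (~: pm [set x]) o \in Acyc (induced e (~: pm [set x])).
  apply: restrict_Acyc => //; apply: symmetric_set_forall => y.
  by rewrite !in_setC symsetN ?pm_sym.
have fA : flip x o \in Acyc e by rewrite fE attach_Acyc.
split=> //.
have -> : [ffun y => (y == x)%:Z - (y == sopp x)%:Z] =
          [ffun y => (y \in [set x])%:Z - (y \in [set sopp x])%:Z].
  by apply/ffunP=> y; rewrite !ffunE !inE.
apply: height_attach => //; rewrite ?pmN //.
- by move=> y /set1P->; rewrite (sink_opp e_undirected).
- by move=> y /set1P->; rewrite fE sink_attach ?set11.
by rewrite fE attachK.
Qed.

(** Up to exchanging x and -x, a flip is one at a source. *)
Lemma source_sinkP x o : o \in Acyc e -> is_source_sink_pair e o x ->
  exists y, [/\ y != szero n, ~~ e y (sopp y), is_source o y & flip x o = flip y o].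
Proof.
move=> oA /and3P[x0 xx /orP[xo|xo]]; first by exists x.
exists (sopp x); rewrite flip_opp soppK e_undirected; split=> //.
  by rewrite (inv_eq (@soppK n)) sopp0.
by rewrite -(sink_opp e_undirected) // soppK.
Qed.

Definition flip_step :=
  [rel o o' | differ_by_flip e o o' || differ_by_flip e o' o].

Lemma flip_stepC : connect_sym flip_step.
Proof. by apply: sym_connect_sym => o o'; rewrite /= orbC. Qed.

Lemma flip_step_height o o' : flip_step o o' ->
  [/\ o \in Acyc e, o' \in Acyc e & exists h, height o o' h].
Proof.
suff H o1 o2 : differ_by_flip e o1 o2 ->
    [/\ o1 \in Acyc e, o2 \in Acyc e & exists h, height o1 o2 h].
  move=> /orP[/H //|/H[oA oA' [h hh]]]; split=> //.
  by eexists; apply: height_sym hh.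
move=> /and3P[oA oA' /existsP[x /andP[/(source_sinkP oA)[y [y0 yy yo ->]] /eqP E]]].
by split=> //; eexists; rewrite E; case: (flip_source_height oA y0 yy yo) => _; apply.
Qed.

Lemma flip_equiv_height o o' : o \in Acyc e -> flip_equiv e o o' ->
  o' \in Acyc e /\ exists h, height o o' h.
Proof.
move=> oA /connectP[s]; elim: s o oA => [o oA _ ->|o1 s IHs o oA /= /andP[st sp] oE].
  by split=> //; exists [ffun=> 0]; apply: height_refl.
have [_ oA1 [h hh]] := flip_step_height st.
have [oA' [h' hh']] := IHs _ oA1 sp oE; split=> //.
by eexists; apply: height_trans hh hh'.
Qed.

Lemma height_gt0 o o' h x : o \in Acyc e -> height o o' h -> 0 < h x ->
  x != szero n /\ ~~ e x (sopp x).
Proof.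
move=> oA /heightP[hN hA] hx; have [oe oO _ _] := AcycP _ e_undirected oA; split.
  by apply/eqP => x0; have := hN x; rewrite x0 sopp0 -x0; lia.
apply/negP => xx; case xy : (arc o x (sopp x)).
  by have := hA _ _ xy; rewrite hN; case: arc => /=; lia.
have yx : arc o (sopp x) x by rewrite oO // xy.
by have := hA _ _ yx; rewrite hN; case: arc => /=; lia.
Qed.

(** Among the vertices of maximal height, one of minimal rank for o' is a sink
    of o': an arc x -> y of o' forces y to be at least as high as x. *)
Lemma exists_descent o o' h : o \in Acyc e -> o' \in Acyc e ->
  height o o' h -> h != [ffun=> 0] -> exists2 x, is_sink o' x & 0 < h x.
Proof.
move=> oA oA' /heightP[hN hA] h0.
have [oe oO _ _] := AcycP _ e_undirected oA.
have [oe' oO' /acyclic_rankP[r rP] _] := AcycP _ e_undirected oA'.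
have [x0 hx0] : exists x, 0 < h x.
  have /existsP[x] : [exists x, h x != 0].
    apply: contraR h0; rewrite negb_exists => /forallP H.
    by apply/eqP/ffunP=> x; rewrite ffunE; apply/eqP; have := H x; rewrite negbK.
  case: (ltgtP (h x) 0) => // hx _; last by exists x.
  by exists (sopp x); rewrite hN oppr_gt0.
pose m := [arg max_(x > x0) h x]%O.
have mP y : h y <= h m by rewrite /m; case: arg_maxP => // i _; apply.
have hm : h m == h m by [].
case: (arg_minnP r (P := [pred x | h x == h m]) hm) => x /eqP hx xmin.
exists x; last by rewrite hx; apply: lt_le_trans (mP x0).
apply/forallP=> y; apply/negP => xy; have := rP _ _ xy; rewrite ltnNge.
rewrite xmin //=; rewrite -hx in mP *; apply/eqP/le_anti; rewrite mP /=.
case xy' : (arc o x y).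
  by have := hA _ _ xy'; rewrite oO' ?oe // xy /=; lia.
have yx : arc o y x by rewrite oO ?oe' // xy'.
by have := hA _ _ yx; rewrite xy /=; have := mP y; lia.
Qed.

(** Flipping a sink of positive height lowers its height by 1, and raises that
    of its opposite by 1, so the sum of absolute heights can be decreased until
    the height vanishes. *)
Lemma height_flip_equiv o o' h : o \in Acyc e -> o' \in Acyc e ->
  height o o' h -> flip_equiv e o o'.
Proof.
move=> oA; have [m] := ubnP (\sum_x absz (h x))%N.
elim: m o' h => // m IHm o' h hm oA' hh.
have [h0|h0] := eqVneq h [ffun=> 0].
  by rewrite h0 in hh; rewrite (height0_eq oA oA' hh); apply: connect0.
have [x xo hx] := exists_descent oA oA' hh h0.
have [x0 xx] := height_gt0 oA hh hx; have [hN _] := heightP _ _ _ hh.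
have x0' : sopp x != szero n by rewrite (inv_eq (@soppK n)) sopp0.
have xx' : ~~ e (sopp x) (sopp (sopp x)) by rewrite soppK e_undirected.
have xo' : is_source o' (sopp x) by rewrite -(sink_opp e_undirected) // soppK.
have [fA hf] := flip_source_height oA' x0' xx' xo'.
apply: (@connect_trans _ _ (flip (sopp x) o')); last first.
  apply: connect1; apply/orP; right; apply/and3P; split=> //.
  by apply/existsP; exists (sopp x); rewrite eqxx andbT; apply/and3P; rewrite xo'.
apply: IHm (height_trans oA oA' fA hh hf) => //.
rewrite -ltnS; apply: leq_trans hm; rewrite ltnS.
rewrite (bigD1 x) // [in X in (_ < X)%N](bigD1 x) //= -addSn leq_add //.
  rewrite !ffunE soppK eqxx eq_sym sopp_eq (negbTE x0) sub0r.
  by move: (h x) hx; clear; lia.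
apply: leq_sum => y yx; rewrite !ffunE soppK (negbTE yx) subr0.
have [->|_] := eqVneq y (sopp x); last by rewrite addr0.
by rewrite hN; move: (h x) hx; clear; lia.
Qed.

Definition base o := fingraph.root flip_step o.

Lemma base_equiv o : flip_equiv e o (base o).
Proof. exact: connect_root. Qed.

Lemma baseP o o' : reflect (base o = base o') (flip_equiv e o o').
Proof. exact: (fingraph.rootP flip_stepC). Qed.

Lemma base_Acyc o : o \in Acyc e -> base o \in Acyc e.
Proof. by move=> oA; have [] := flip_equiv_height oA (base_equiv o). Qed.

Lemma base_height_exists o : exists h, (o \in Acyc e) ==> height (base o) o h.
Proof.
have [oA|_] := boolP (o \in Acyc e); last by exists [ffun=> 0].
have bo : flip_equiv e (base o) o.
  by apply/baseP; rewrite /base (root_root flip_stepC).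
by have [_ [h hh]] := flip_equiv_height (base_Acyc oA) bo; exists h.
Qed.

Definition base_height o : {ffun signed n -> int} := xchoose (base_height_exists o).

Lemma base_heightP o : o \in Acyc e -> height (base o) o (base_height o).
Proof. exact/implyP/(xchooseP (base_height_exists o)). Qed.

Lemma base_heightN o x : o \in Acyc e -> base_height o (sopp x) = - base_height o x.
Proof. by move=> /base_heightP/heightP[]. Qed.

Lemma base_height_trans o o' h : o \in Acyc e -> o' \in Acyc e -> height o o' h ->
  base_height o' = [ffun x => base_height o x + h x].
Proof.
move=> oA oA' hh; have bE := baseP _ _ (height_flip_equiv oA oA' hh).
apply: (height_unique (base_Acyc oA')); first exact: base_heightP.
rewrite -bE; apply: height_trans (base_heightP oA) hh => //; exact: base_Acyc.
Qed.

(** The vertices whose flips move o closer to the base of its class. *)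
Definition descents o := [set x in sinks o | 0 < base_height o x].

Lemma descents_eq0 o : o \in Acyc e -> (descents o == set0) = (base o == o).
Proof.
move=> oA; have bA := base_Acyc oA; apply/eqP/eqP => [D0|bo].
  apply: (height0_eq bA oA); have := base_heightP oA.
  have [-> //|h0] := eqVneq (base_height o) [ffun=> 0].
  have [x xo hx] := exists_descent bA oA (base_heightP oA) h0.
  by have := in_set0 x; rewrite -D0 !inE xo hx.
apply/setP=> x; rewrite !inE; have := base_heightP oA; rewrite bo => hh.
by rewrite (height_unique oA hh (height_refl oA)) ffunE ltxx andbF.
Qed.

Lemma descents_antisym o S : o \in Acyc e -> S \subset descents o ->
  antisymmetric_set S.
Proof.
move=> oA /subsetP SD; apply/antisymP=> x /SD; rewrite !inE => /andP[_ hx].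
by apply/negP => /SD; rewrite !inE base_heightN // => /andP[_]; lia.
Qed.

Lemma descents_pmK o S : o \in Acyc e -> S \subset descents o ->
  descents o :&: pm S = S.
Proof.
move=> oA SD; apply/setP=> x; rewrite in_setI mem_pm.
have [xS|xS] /= := boolP (x \in S); first by rewrite (subsetP SD).
apply/negP => /andP[xD /(subsetP SD) xD'].
by have /antisymP/(_ _ xD)/negP := descents_antisym oA (subxx _).
Qed.

(** Adjacent vertices have heights that differ by at most 1, so no vertex of S is
    adjacent to a vertex of -S; two sinks are not adjacent either.  Thus all
    flips at S can be made independently. *)
Lemma descents_admissible o S : o \in Acyc e -> S \subset descents o ->
  admissible e setT (pm S).
Proof.
move=> oA SD; have SA := descents_antisym oA SD.
have [oe oO _ oS] := AcycP _ e_undirected oA.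
have [boe boO _ _] := AcycP _ e_undirected (base_Acyc oA).
have [hN hA] := heightP _ _ _ (base_heightP oA).
apply/and4P; split; rewrite ?subsetT ?pm_sym //.
  by rewrite mem_pm sopp0 orbb antisym0.
have D1 x : x \in S -> is_sink o x /\ 0 < base_height o x.
  by move/(subsetP SD); rewrite !inE => /andP.
have SI x y : x \in S -> y \in S -> e x y = false.
  move=> /D1[/forallP xo _] /D1[/forallP yo _]; apply/negP => xy.
  by have := oO _ _ xy; rewrite !(negbTE (xo _)) (negbTE (yo _)).
have SI' x y : x \in S -> sopp y \in S -> e x y = false.
  move=> /D1[_ hx] /D1[_]; rewrite hN => hy; apply/negP => xy.
  case bxy : (arc (base o) x y).
    by have := hA _ _ bxy; case: arc => /=; lia.
  have byx : arc (base o) y x by rewrite boO // bxy.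
  by have := hA _ _ byx; case: arc => /=; lia.
apply/independentP => x y; rewrite !mem_pm => /orP[xS|xS] /orP[yS|yS].
- exact: SI.
- exact: SI'.
- by rewrite e_undirected SI'.
by rewrite -(graphN e_symmetric) SI.
Qed.

(** Each cube has a unique corner o farthest from the base.  Injectivity: two
    corners of the same cube are in the same class, and if x in W is a sink in
    the first only, its height drops from a positive value to a negative one,
    while it changes by 1.  Surjectivity: starting from any corner o1, make x a
    sink exactly when the height of x in the position of a source is
    nonnegative. *)
Lemma card_Acyc_descents W : admissible e setT W ->
  #|Acyc (induced e (setT :\: W))| =
  #|[set o in Acyc e | pm (descents o :&: W) == W]|.
Proof.
move=> WP.
have [S0 [S0A S0W W2]] :
  exists S0, [/\ antisymmetric_set S0, S0 \subset W & W = pm S0].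
  have [W2 _] := pm_admissible WP; exists (positive_half W).
  split; rewrite ?positive_half_antisym //.
  by apply/subsetP=> x; rewrite inE => /andP[].
case/and4P: WP => _ Ws W0 WI.
rewrite setTD; set B := [set o in _ | _].
have inB o : o \in B -> [/\ o \in Acyc e, antisymmetric_set (descents o :&: W),
    pm (descents o :&: W) = W & {in descents o :&: W, forall x, is_sink o x}].
  rewrite in_set => /andP[oA /eqP DW]; split=> //.
    by apply: descents_antisym oA _; apply: subsetIl.
  by move=> x; rewrite !inE => /andP[/andP[]].
have sub o1 o2 : o1 \in B -> o2 \in B -> restrict (~: W) o1 = restrict (~: W) o2 ->
    descents o1 :&: W \subset descents o2 :&: W.
  move=> /inB[oA1 SA1 S1 So1] /inB[oA2 SA2 S2 So2] E.
  have hh : height o1 o2 [ffun x => (x \in descents o2 :&: W)%:Z -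
                                    (x \in descents o1 :&: W)%:Z].
    by apply: (height_attach oA1 oA2 SA1 SA2 _ _ So1 So2); rewrite S1 ?S2.
  have hE := base_height_trans oA1 oA2 hh.
  apply/subsetP => x xS1; apply: contraT => xS2.
  have : x \in pm (descents o2 :&: W).
    by rewrite S2; move: xS1; rewrite inE => /andP[].
  rewrite mem_pm (negbTE xS2) /= => xS2'.
  have : 0 < base_height o2 (sopp x) by move: xS2'; rewrite !inE => /andP[/andP[]].
  have : 0 < base_height o1 x by move: xS1; rewrite !inE => /andP[/andP[]].
  rewrite base_heightN // hE !ffunE xS1 (negbTE xS2) /=.
  by move: (base_height o1 x); clear; lia.
rewrite -(card_in_imset (f := restrict (~: W)) (D := B)); last first.
  move=> o1 o2 o1B o2B E.
  have DE : descents o1 :&: W = descents o2 :&: W.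
    by apply/eqP; rewrite eqEsubset (sub _ _ o1B o2B E) (sub _ _ o2B o1B (esym E)).
  have [oA1 _ S1 So1] := inB _ o1B; have [oA2 _ S2 So2] := inB _ o2B.
  rewrite -(restrictK e_undirected e_symmetric oA1 So1) S1 E DE.
  by rewrite -[RHS](restrictK e_undirected e_symmetric oA2 So2) S2.
congr #|pred_of_set _|; apply/setP=> o0.
apply/idP/imsetP => [oA0|[o /inB[oA _ _ _] ->]]; last first.
  by apply: restrict_Acyc => //; apply: symmetric_set_forall => x; rewrite !in_setC symsetN.
have subI S : S \subset W -> independent e S.
  move=> /subsetP SW; apply/independentP=> x y /SW xW /SW yW.
  by move/independentP: WI => ->.
have oA1 : attach e S0 o0 \in Acyc e by rewrite attach_Acyc ?subI // -W2.
set o1 := attach e S0 o0 in oA1.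
(* A sink, such as those of S0 in o1, is one step higher than in source position. *)
pose S := [set x in W | (x \in S0)%:Z <= base_height o1 x].
have mS x : (x \in S) = (x \in W) && ((x \in S0)%:Z <= base_height o1 x).
  by rewrite in_set.
have SW : S \subset W by apply/subsetP=> x; rewrite mS => /andP[].
have S0N x : x \in W -> (sopp x \in S0) = (x \notin S0).
  rewrite W2 mem_pm; case: (boolP (x \in S0)) => [|//].
  by move/antisymP: S0A => H /H/negbTE.
have SN x : x \in W -> (sopp x \in S) = (x \notin S).
  move=> xW; rewrite !mS symsetN // xW S0N // base_heightN //=.
  by move: (base_height o1 x) (x \in S0) => a []; clear; lia.
have SA : antisymmetric_set S.
  by apply/antisymP=> x xS; rewrite SN ?(subsetP SW) // xS.
have SE : pm S = W.
  apply/setP=> x; rewrite mem_pm; have [xW|xW] := boolP (x \in W).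
    by rewrite SN // orbN.
  by apply/negP => /orP[] /(subsetP SW); rewrite ?symsetN // (negbTE xW).
have oA : attach e S o0 \in Acyc e by rewrite attach_Acyc ?subI // SE.
have hh : height o1 (attach e S o0) [ffun x => (x \in S)%:Z - (x \in S0)%:Z].
  apply: height_attach; rewrite -?W2 ?SE //.
  - by move=> x xS; apply: sink_attach; rewrite ?subI.
  - by move=> x xS; apply: sink_attach; rewrite ?subI.
  by rewrite {1}W2 -{1}SE !attachK // ?SE -?W2.
exists (attach e S o0); last by rewrite -{1}SE attachK ?SE.
rewrite in_set oA /= eqEsubset; apply/andP; split.
  by apply/subsetP=> x; rewrite mem_pm !inE symsetN // => /orP[] /andP[].
have SD : S \subset descents (attach e S o0) :&: W.
  apply/subsetP=> x xS; rewrite in_setI (subsetP SW) // andbT !inE.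
  rewrite sink_attach ?subI //= (base_height_trans oA1 oA hh) !ffunE xS.
  move: xS; rewrite mS => /andP[_].
  by move: (base_height o1 x) (x \in S0) => a []; clear; lia.
rewrite -{1}SE; apply/subsetP=> x; rewrite !mem_pm => /orP[] /(subsetP SD) ->//.
by rewrite orbT.
Qed.

Lemma card_flip_classes :
  #|flip_classes e| = #|[set o in Acyc e | base o == o]|.
Proof.
set A := [set o in _ | _]; pose cl o := [set o' in Acyc e | flip_equiv e o o'].
have clE o o' : flip_equiv e o o' -> cl o = cl o'.
  move=> oo'; apply/setP=> o2; rewrite !in_set; congr (_ && _).
  exact: (same_connect flip_stepC oo').
rewrite -(card_in_imset (f := cl) (D := A)) => [|o1 o2]; last first.
  rewrite !in_set => /andP[oA1 /eqP E1] /andP[oA2 /eqP E2] /setP/(_ o2).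
  rewrite !in_set oA2 /= => H; rewrite -E1 -E2; apply/baseP; rewrite H.
  exact: connect0.
congr #|pred_of_set _|; apply/setP=> C; apply/imsetP/imsetP => -[o].
  move=> oA ->; exists (base o); last exact/clE/base_equiv.
  by rewrite in_set base_Acyc //= /base (root_root flip_stepC).
by rewrite in_set => /andP[oA _] ->; exists o.
Qed.

(** Grouped by farthest corner o, the cubes at o correspond to the subsets of
    [descents o], whose alternating sum is 0 unless o is the base of its class. *)
Lemma cube_sum_flip_classes : cube_sum e setT = #|flip_classes e|%:Z.
Proof.
rewrite card_flip_classes.
transitivity (\sum_(o in Acyc e)
   \sum_(W | admissible e setT W && (pm (descents o :&: W) == W)) (-1) ^+ #|W|./2 : int).
  rewrite (exchange_big_dep (admissible e setT)) /=; last by move=> o W _ /andP[].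
  apply: eq_bigr => W WP; rewrite card_Acyc_descents //.
  rewrite (eq_bigl [in [set o in Acyc e | pm (descents o :&: W) == W]]); last first.
    by move=> o; rewrite WP inE /= in_set.
  by rewrite sumr_const -mulr_natr natz.
transitivity (\sum_(o in Acyc e) (base o == o)%:R : int); last first.
  rewrite (eq_bigr (fun o => if base o == o then 1 else 0)); last first.
    by move=> o _; case: eqP.
  rewrite -big_mkcondr -natz -sumr_const; apply: eq_bigl => o.
  by rewrite in_set.
apply: eq_bigr => o oA; rewrite -descents_eq0 // -alternating_sum_subsets.
rewrite (reindex_onto (@pm n) (fun W => descents o :&: W)) /=; last first.
  by move=> W /andP[_ /eqP].
have condE S : (admissible e setT (pm S) && (pm (descents o :&: pm S) == pm S)) &&
               (descents o :&: pm S == S) = (S \subset descents o).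
  apply/idP/idP => [/andP[_ /eqP <-]|SD]; first exact: subsetIl.
  by rewrite descents_pmK // !eqxx (descents_admissible oA SD).
rewrite (eq_bigl _ _ condE); apply: eq_bigr => S SD.
by rewrite card_pm ?doubleK // (descents_antisym oA SD).
Qed.

End Heights.

Theorem theorem2p10 (n : nat) (e : rel (signed n))
    (e_undirected : symmetric e) (e_loopless : irreflexive e)
    (e_symmetric : symmetric_graph e) (e_weakly_connected : weakly_connected e) :
  #|flip_classes e|%:Z = (-1) ^+ n * (bichromatic_poly e).[-1, 2].
Proof.
have Ts : symmetric_set [set: signed n] by apply: symmetric_set_forall => x; rewrite !inE.
rewrite -coloring_polyT coloring_poly_cube_sum // cube_sum_flip_classes //.
have -> : (#|[set: signed n]|./2 = n)%N by rewrite cardsT card_ord; lia.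
by rewrite mulrA -expr2 sqrr_sign mul1r.
Qed.
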